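(* There is an absolute constant $c_1>0$ with the following property. Let $Q,N\in\mathbb{N}$, let $(a_n)_{n\in\mathbb{Z}[i]}$ be any sequence of complex numbers, put $Z=\sum_{n\in\mathbb{Z}[i],\ \mathcal{N}(n)\le N}|a_n|^2$, and let $\mathcal{S}\subseteq B(0,Q^{1/2})\cap(\mathbb{Z}[i]\setminus\{0\})$. Then $$\sum_{q\in\mathcal{S}}\ \sum_{\substack{a\bmod q\\ (a,q)=1}}\Big|\sum_{\substack{n\in\mathbb{Z}[i]\\ \mathcal{N}(n)\le N}} a_n\, e\Big(\Re\Big(\frac{na}{q}\Big)\Big)\Big|^2 \le c_1 N Z\left(1+\sup_{\substack{r\in\mathbb{Z}[i]\setminus\{0\}\\ 1\le|r|\le N^{1/4}}}\ \sup_{\substack{z\in\mathbb{C}\\ N^{-1/2}\le|z|\le \frac{2}{|r|N^{1/4}}}}\ \sup_{\substack{h\in\mathbb{Z}[i]\\ (h,r)=1}}\ \sum_{t\mid r}\ \sum_{\substack{m\in\mathbb{Z}[i],\ 0<|m|\le \frac{3|rz|\sqrt{Q}}{|t|}\\ (m,\frac{r}{t})=1}} A_t\Big(\frac{\sqrt{Q}}{\sqrt{N}\,|zt|},\frac{r}{t},hm\Big)\right).$$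
   Context: $e(x)=e^{2\pi i x}$. $\mathbb{Z}[i]$ denotes the Gaussian integers and $\mathcal{N}(q)=\Re(q)^2+\Im(q)^2$ the norm. For $y\in\mathbb{C}$, $u\ge 0$, $B(y,u)=\{w\in\mathbb{C}:|w-y|\le u\}$. ''$a\bmod q$, $(a,q)=1$'' means $a$ runs over a complete system of residues modulo $q$ in $\mathbb{Z}[i]$ coprime to $q$. The sum over $t\mid r$ runs over a maximal set of mutually non-associate divisors $t$ of $r$ in $\mathbb{Z}[i]$. For $t\in\mathbb{Z}[i]\setminus\{0\}$, $\mathcal{S}_t=\{q\in\mathbb{Z}[i]: tq\in\mathcal{S}\}$, and for $u\ge0$, $k\in\mathbb{Z}[i]\setminus\{0\}$, $l\in\mathbb{Z}[i]$, $$A_t(u,k,l)=\sup_{y\in\mathbb{C},\ |y|\le \sqrt{Q}/|t|}\big|\{q\in\mathcal{S}_t\cap B(y,u): q\equiv l \bmod k\}\big|.$$ *)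

(* Defs.v *)
From HB Require Import structures.
From mathcomp Require Import all_boot all_order all_algebra.
From mathcomp Require Import boolp classical_sets reals trigo.
From mathcomp Require Import complex.
Set Implicit Arguments. Unset Strict Implicit. Unset Printing Implicit Defensive.
Import Order.TTheory GRing.Theory Num.Theory.
Local Open Scope ring_scope.

(* Gaussian integers Z[i], represented as pairs (real part, imaginary part). *)
Definition gi := (int * int)%type.

Definition gadd (x y : gi) : gi := (x.1 + y.1, x.2 + y.2).
Definition gsub (x y : gi) : gi := (x.1 - y.1, x.2 - y.2).
Definition gmul (x y : gi) : gi := (x.1 * y.1 - x.2 * y.2, x.1 * y.2 + x.2 * y.1).
Definition gconj (x : gi) : gi := (x.1, - x.2).
Definition gnorm (x : gi) : int := x.1 ^+ 2 + x.2 ^+ 2.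

Definition gdvd (d x : gi) : Prop := exists k : gi, x = gmul d k.
Definition gunit (u : gi) : Prop := exists v : gi, gmul u v = (1, 0).
Definition gcoprime (a b : gi) : Prop :=
  forall d : gi, gdvd d a -> gdvd d b -> gunit d.
Definition gassoc (d t : gi) : Prop := exists u : gi, gunit u /\ d = gmul u t.
Definition gcong (a b k : gi) : Prop := gdvd k (gsub a b).

(* exact quotient x / d (meaningful when d divides x, d <> 0) *)
Definition gquo (x d : gi) : gi :=
  (((gmul x (gconj d)).1 %/ gnorm d)%Z, ((gmul x (gconj d)).2 %/ gnorm d)%Z).

Definition is_crs (q : gi) (s : seq gi) : Prop :=
  uniq s /\ forall x : gi, exists! a : gi, a \in s /\ gcong x a q.

Definition is_divsys (r : gi) (s : seq gi) : Prop :=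
  uniq s /\ (forall t, t \in s -> gdvd t r) /\
  forall d : gi, gdvd d r -> exists! t : gi, t \in s /\ gassoc d t.

Definition gbox (K : nat) : seq gi :=
  [seq ((i%:Z - K%:Z), (j%:Z - K%:Z)) | i <- iota 0 (2 * K).+1, j <- iota 0 (2 * K).+1].

Section Analytic.
Variable R : realType.

Definition gtoC (x : gi) : R[i] := (x.1%:~R +i* x.2%:~R)%C.

Definition cabs (w : R[i]) : R := ComplexField.Normc.normc w.
Definition gabs (q : gi) : R := cabs (gtoC q).

Definition gball_seq (y : R[i]) (u : R) : seq gi :=
  [seq q <- gbox (Num.truncn (cabs y + u)) | cabs (gtoC q - y) <= u].

Definition ee (x : R) : R[i] := (cos (2 * pi * x) +i* sin (2 * pi * x))%C.

Definition Acount (S : seq gi) (t : gi) (u : R) (k l : gi) (y : R[i]) : nat :=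
  count (fun q => (gmul t q \in S) && `[< gcong q l k >]) (gball_seq y u).

Definition A_t (Q : nat) (S : seq gi) (t : gi) (u : R) (k l : gi) : R :=
  sup [set x : R | exists y : R[i],
         cabs y <= Num.sqrt (Q%:R) / gabs t /\ x = (Acount S t u k l y)%:R].

Definition inner_sum (Q N : nat) (S : seq gi) (ds : gi -> seq gi)
    (r : gi) (z : R[i]) (h : gi) : R :=
  \sum_(t <- ds r)
    \sum_(m <- gball_seq 0 (3 * cabs (gtoC r * z) * Num.sqrt (Q%:R) / gabs t)
          | (m != (0, 0)) && `[< gcoprime m (gquo r t) >])
      A_t Q S t (Num.sqrt (Q%:R) / (Num.sqrt (N%:R) * cabs (z * gtoC t)))
          (gquo r t) (gmul h m).

Definition sup_set (Q N : nat) (S : seq gi) (ds : gi -> seq gi) : set R :=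
  [set x : R | exists (r : gi) (z : R[i]) (h : gi),
     [/\ r != (0, 0),
         1 <= gabs r <= Num.sqrt (Num.sqrt (N%:R)),
         (Num.sqrt (N%:R))^-1 <= cabs z <= 2 / (gabs r * Num.sqrt (Num.sqrt (N%:R))),
         gcoprime h r &
         x = inner_sum Q N S ds r z h]].

Definition lhs (N : nat) (a : gi -> R[i]) (S : seq gi) (crs : gi -> seq gi) : R :=
  \sum_(q <- S) \sum_(b <- crs q | `[< gcoprime b q >])
     cabs (\sum_(n <- gbox N | gnorm n <= N%:Z)
              a n * ee (complex.Re (gtoC n * gtoC b / gtoC q))) ^+ 2.

Definition Zsum (N : nat) (a : gi -> R[i]) : R :=
  \sum_(n <- gbox N | gnorm n <= N%:Z) cabs (a n) ^+ 2.

End Analytic.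

(* Main.v *)
Require Import Defs.
From HB Require Import structures.
From mathcomp Require Import all_boot all_order all_algebra.
From mathcomp Require Import boolp classical_sets reals trigo.
From mathcomp Require Import complex.
From mathcomp Require Import zify ring lra.

(* By duality and a Fejer weight, the large sieve over the torus C/Z[i] reduces the
   left-hand side to [N Z] times the largest number of fractions [a/q] in a disc of
   radius a small multiple of N^(-1/2) about a point [al].  Dirichlet's theorem in
   Z[i] gives [al = b/r + z] with |r| <= N^(1/4) and |z| <= 2/(|r| N^(1/4)); when
   |z| < N^(-1/2) the disc is covered by the four discs about [b/r + w] with
   w = N^(-1/2) i^j.  For a fraction in such a disc put [m = a r - b q].  If [m = 0]
   then [q] is associate to [r], which leaves at most four fractions.  Otherwise, with
   [t = gcd(m, r)], the quotient [q/t] is congruent to [h m/t] modulo [r/t], where [-h]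
   inverts [b] modulo [r], and lies in a disc about [m/(r z t)], so these fractions are
   counted by the triple sum on the right. *)

Import Defs.
Set Implicit Arguments. Unset Strict Implicit. Unset Printing Implicit Defensive.
Import Order.TTheory GRing.Theory Num.Theory.
Local Open Scope ring_scope.

(** * Arithmetic of Gaussian integers *)

(** The sharp cut-off to a box of frequencies is majorised by Fejer weights because their kernel is
    nonnegative and decays like the inverse square of the distance. A row sum then costs a constant
    times the number of points in one cell, without a logarithm, and no separation of the fractions
    is assumed. The scale H between 2 sqrt N and 4 sqrt N serves two ends: a cell of side 1/H must
    fit in a disc so small (radius d with 8 d^2 <= 1/N) that four discs of radius N^(-1/2) still
    cover it, while H^2 must stay O(N). Three mismatches need care. Closeness on the torus holds
    only up to Gaussian integers, so each numerator a is first shifted by a multiple of q. A real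
    supremum dominates its set only if the set is bounded above, and its sign is known only through
    a member, which Dirichlet's theorem supplies. *)

Ltac gring := rewrite /gmul /gadd /gsub /gconj /=; congr pair; ring.

Lemma gmulC x y : gmul x y = gmul y x. Proof. gring. Qed.
Lemma gmulA x y z : gmul x (gmul y z) = gmul (gmul x y) z. Proof. gring. Qed.
Lemma gmulDr x y z : gmul x (gadd y z) = gadd (gmul x y) (gmul x z).
Proof. gring. Qed.
Lemma gmulBr x y z : gmul x (gsub y z) = gsub (gmul x y) (gmul x z).
Proof. gring. Qed.
Lemma gmul1 x : gmul x (1, 0) = x. Proof. case: x => a b; gring. Qed.
Lemma g1mul x : gmul (1, 0) x = x. Proof. case: x => a b; gring. Qed.
Lemma gmul0 x : gmul x (0, 0) = (0, 0). Proof. gring. Qed.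

Lemma gnormM x y : gnorm (gmul x y) = gnorm x * gnorm y.
Proof. rewrite /gnorm /gmul /=; ring. Qed.

Lemma gnorm_ge0 x : 0 <= gnorm x.
Proof. by rewrite /gnorm addr_ge0 ?sqr_ge0. Qed.

Lemma gnorm_eq0 x : (gnorm x == 0) = (x == (0, 0)).
Proof.
case: x => a b; rewrite /gnorm /= paddr_eq0 ?sqr_ge0 // !sqrf_eq0.
by rewrite xpair_eqE.
Qed.

Lemma gnorm_gt0 x : x != (0, 0) -> 0 < gnorm x.
Proof. by move=> hx; rewrite lt_def gnorm_ge0 gnorm_eq0 hx. Qed.

Lemma gmul_eq0 x y : (gmul x y == (0, 0)) = (x == (0, 0)) || (y == (0, 0)).
Proof. by rewrite -!gnorm_eq0 gnormM mulf_eq0. Qed.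

Lemma gsub_eq0 x y : gsub x y = (0, 0) -> x = y.
Proof.
case: x y => a b [c d] [/eqP + /eqP]; rewrite !subr_eq0 => /eqP /= -> /eqP /= -> //.
Qed.

Lemma gmulI x y z : x != (0, 0) -> gmul x y = gmul x z -> y = z.
Proof.
move=> hx e; apply: gsub_eq0; apply/eqP.
have : gmul x (gsub y z) == (0, 0) by rewrite gmulBr e; apply/eqP; gring.
by rewrite gmul_eq0 (negbTE hx).
Qed.

Lemma gdvd_trans y x z : gdvd x y -> gdvd y z -> gdvd x z.
Proof. by move=> [k ->] [l ->]; exists (gmul k l); rewrite gmulA. Qed.

Lemma gdvd_mulr x y z : gdvd x y -> gdvd x (gmul y z).
Proof. by move=> [k ->]; exists (gmul k z); rewrite gmulA. Qed.

Lemma gdvdD x y z : gdvd x y -> gdvd x z -> gdvd x (gadd y z).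
Proof. by move=> [k ->] [l ->]; exists (gadd k l); rewrite gmulDr. Qed.

Lemma gdvd1_unit d : gdvd d (1, 0) -> gunit d.
Proof. by move=> [k e]; exists k. Qed.

(** Rounding x/n to the nearest integer, with the error bound |x/n - k| <= 1/2 cleared of
    denominators and squared. *)
Lemma nearest_int (x n : int) : 0 < n ->
  exists k : int, (2 * (x - k * n)) ^+ 2 <= n ^+ 2.
Proof.
move=> n0; exists ((2 * x + n) %/ (2 * n))%Z.
have := divz_eq (2 * x + n) (2 * n).
have h0 : 0 <= ((2 * x + n) %% (2 * n))%Z by apply: modz_ge0; lia.
have h1 : ((2 * x + n) %% (2 * n))%Z < 2 * n by apply: ltz_pmod; lia.
move: h0 h1; set k := (_ %/ _)%Z; set m := (_ %% _)%Z => h0 h1 e.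
have : - n <= 2 * (x - k * n) <= n by lia.
by move=> /andP[? ?]; nia.
Qed.

(** Both coordinates of m/r = m conj(r) / n are rounded, n being the norm of r; each error is at
    most 1/2, so the remainder has norm at most n/2. *)
Lemma geuclid (m r : gi) : r != (0, 0) ->
  exists k, gnorm (gsub m (gmul r k)) < gnorm r.
Proof.
move=> r0; have n0 := gnorm_gt0 r0; set n := gnorm r in n0 *.
have [k1 h1] := nearest_int (gmul m (gconj r)).1 n0.
have [k2 h2] := nearest_int (gmul m (gconj r)).2 n0.
exists (k1, k2).
have e : gnorm (gsub m (gmul r (k1, k2))) * n =
   ((gmul m (gconj r)).1 - k1 * n) ^+ 2 + ((gmul m (gconj r)).2 - k2 * n) ^+ 2.
  rewrite /n /gnorm /gsub /gmul /gconj /=; ring.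
move: e h1 h2; set p := _ - k1 * n; set s := _ - k2 * n.
set G := gnorm _ => e h1 h2.
have : 4 * (G * n) <= 2 * n ^+ 2 by rewrite e; lia.
nia.
Qed.

Lemma gbezout (a b : gi) : exists g x y,
  [/\ gdvd g a, gdvd g b & g = gadd (gmul a x) (gmul b y)].
Proof.
have [n] := ubnP `|gnorm b|%N; elim: n a b => // n IHn a b hb.
have [->|b0] := eqVneq b (0, 0).
  exists a, (1, 0), (0, 0); split; first by exists (1, 0); rewrite gmul1.
    by exists (0, 0); rewrite gmul0.
  by rewrite gmul1 gmul0; case: (a) => ? ?; gring.
have [k hk] := geuclid a b0.
have [|g [x [y [gb gr e]]]] := IHn b (gsub a (gmul b k)).
  have := gnorm_ge0 (gsub a (gmul b k)); lia.
exists g, y, (gsub x (gmul k y)); split => //.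
  have -> : a = gadd (gsub a (gmul b k)) (gmul b k) by case: (a) => ? ?; gring.
  by apply: gdvdD => //; apply: gdvd_mulr.
rewrite e; gring.
Qed.

Lemma gcoprime_bezout a b : gcoprime a b ->
  exists x y, gadd (gmul a x) (gmul b y) = (1, 0).
Proof.
move=> co; have [g [x [y [ga gb e]]]] := gbezout a b.
have [v hv] := co _ ga gb; exists (gmul x v), (gmul y v).
by rewrite -hv e; gring.
Qed.

Lemma bezout_gcoprime a b x y : gadd (gmul a x) (gmul b y) = (1, 0) ->
  gcoprime a b.
Proof.
move=> e d da db; apply: gdvd1_unit; rewrite -e.
by apply: gdvdD; apply: gdvd_mulr.
Qed.

Lemma gdvd_gauss q a r : gcoprime a q -> gdvd q (gmul a r) -> gdvd q r.
Proof.
move=> /gcoprime_bezout [x [y e]] qar.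
have -> : r = gadd (gmul (gmul a r) x) (gmul q (gmul y r)).
  by rewrite -[LHS]g1mul -e; gring.
by apply: gdvdD; apply: gdvd_mulr => //; exists (1, 0); rewrite gmul1.
Qed.

Lemma gquo_mul t k : t != (0, 0) -> gquo (gmul t k) t = k.
Proof.
move=> t0; have n0 : gnorm t != 0 by rewrite gnorm_eq0.
have e1 : (gmul (gmul t k) (gconj t)).1 = k.1 * gnorm t.
  by rewrite /gmul /gnorm /gconj /=; ring.
have e2 : (gmul (gmul t k) (gconj t)).2 = k.2 * gnorm t.
  by rewrite /gmul /gnorm /gconj /=; ring.
by rewrite /gquo e1 e2 !mulzK //; case: (k).
Qed.

Lemma gunit_mem u : gunit u -> u \in [:: (1, 0); (-1, 0); (0, 1); (0, -1)].
Proof.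
move=> [v e]; have : gnorm u * gnorm v = 1 by rewrite -gnormM e.
have := gnorm_ge0 u; have := gnorm_ge0 v => hv hu huv.
have {huv hv hu} : gnorm u = 1.
  have /eqP : absz (gnorm u * gnorm v) = 1%N by rewrite huv.
  by rewrite abszM muln_eq1 => /andP[/eqP ? _]; lia.
case: u {e} => a b; rewrite /gnorm /= => h.
have ha : a = 0 \/ a = 1 \/ a = -1.
    have : -1 <= a <= 1 by nia.
    lia.
have hb : b = 0 \/ b = 1 \/ b = -1.
    have : -1 <= b <= 1 by nia.
    lia.
by case: ha h => [|[|]] -> ; case: hb => [|[|]] -> //.
Qed.

(** The Bezout gcd need not belong to the chosen list of divisors, so its listed associate t
    replaces it; dividing the Bezout relation by t gives coprimality of the cofactors. *)
Lemma divsys_gcd (m r : gi) (s : seq gi) : r != (0, 0) -> is_divsys r s ->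
  exists t m' k, [/\ t \in s, t != (0, 0), m = gmul t m', r = gmul t k &
    gcoprime m' k].
Proof.
move=> r0 [_ [_ hs]]; have [g [x [y [gm gr e]]]] := gbezout m r.
have [t [[ts [u [[v uv] gut]]] _]] := hs g gr.
have tg : gdvd t g by exists u; rewrite gut gmulC.
have [m' em] := gdvd_trans tg gm; have [k ek] := gdvd_trans tg gr.
have t0 : t != (0, 0).
  by apply: contra_neq r0 => t0; rewrite ek t0 gmulC gmul0.
exists t, m', k; split => //.
apply: (@bezout_gcoprime _ _ (gmul x v) (gmul y v)).
apply: (@gmulI t) => //.
have -> : gmul t (gadd (gmul m' (gmul x v)) (gmul k (gmul y v))) =
   gmul (gadd (gmul m x) (gmul r y)) v by rewrite em ek; gring.
by rewrite -e gut -gmulA [gmul t v]gmulC gmulA uv gmulC.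
Qed.

(** * The large sieve inequality on the two-dimensional torus *)

Section ComplexModulus.
Context {R : realType}.
Implicit Types z w : R[i].

Lemma cabs_ge0 z : 0 <= cabs z.
Proof. by case: z => a b; rewrite /cabs /= sqrtr_ge0. Qed.

Lemma cabsM z w : cabs (z * w) = cabs z * cabs w.
Proof. exact: ComplexField.Normc.normcM. Qed.

Lemma cabsV z : cabs z^-1 = (cabs z)^-1.
Proof. exact: ComplexField.Normc.normcV. Qed.

Lemma cabsD z w : cabs (z + w) <= cabs z + cabs w.
Proof. exact: le_normcD. Qed.

Lemma cabsN z : cabs (- z) = cabs z.
Proof. exact: normcN. Qed.

Lemma cabs0 : cabs (0 : R[i]) = 0.
Proof. exact: ComplexField.Normc.normc0. Qed.

Lemma cabs1 : cabs (1 : R[i]) = 1.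
Proof. exact: ComplexField.Normc.normc1. Qed.

Lemma cabs_eq0 z : (cabs z == 0) = (z == 0).
Proof.
apply/eqP/eqP => [/ComplexField.Normc.eq0_normc //|->]; exact: cabs0.
Qed.

Lemma sqr_cabs z : cabs z ^+ 2 = complex.Re z ^+ 2 + complex.Im z ^+ 2.
Proof. by case: z => a b; rewrite /cabs /= sqr_sqrtr // addr_ge0 ?sqr_ge0. Qed.

Lemma sqr_cabsC z : ((cabs z ^+ 2)%:C)%C = z * (z^*)%C.
Proof.
rewrite sqr_cabs; case: z => a b /=; apply/eqP.
rewrite eq_complex /=; apply/andP; split; apply/eqP; ring.
Qed.

Lemma cabs_real (x : R) : 0 <= x -> cabs (x%:C)%C = x.
Proof. by move=> x0; rewrite /cabs /= expr0n addr0 sqrtr_sqr ger0_norm. Qed.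

Lemma cabsJ z : cabs (z^*)%C = cabs z.
Proof. by case: z => a b; rewrite /cabs /= sqrrN. Qed.

Lemma cabs_sum I (s : seq I) (F : I -> R[i]) :
  cabs (\sum_(i <- s) F i) <= \sum_(i <- s) cabs (F i).
Proof.
elim: s => [|x s IH]; first by rewrite !big_nil cabs0.
by rewrite !big_cons (le_trans (cabsD _ _)) // lerD2l.
Qed.

Lemma rcsum I (s : seq I) (F : I -> R) :
  ((\sum_(i <- s) F i)%:C = \sum_(i <- s) (F i)%:C :> R[i])%C.
Proof. exact: (rmorph_sum (real_complex R)). Qed.

Lemma conj_sum I (s : seq I) (F : I -> R[i]) :
  ((\sum_(i <- s) F i)^*)%C = \sum_(i <- s) ((F i)^*)%C.
Proof. exact: (rmorph_sum (@conjc R)). Qed.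

Lemma conjM z w : ((z * w)^*)%C = (z^*)%C * (w^*)%C.
Proof. exact: (rmorphM (@conjc R)). Qed.

End ComplexModulus.

(** * Additive characters and pointwise bounds for the Fejer kernel *)

Section AdditiveCharacter.
Context {R : realType}.
Implicit Types x y f : R.

Lemma eeD x y : ee (x + y) = ee x * ee y.
Proof.
rewrite /ee mulrDr cosD sinD; apply/eqP; rewrite eq_complex /=.
by apply/andP; split; apply/eqP; ring.
Qed.

Lemma ee0 : ee (0 : R) = 1.
Proof. by rewrite /ee mulr0 cos0 sin0. Qed.

Lemma conj_ee x : ((ee x)^*)%C = ee (- x).
Proof. by rewrite /ee mulrN cosN sinN. Qed.

Lemma cabs_ee x : cabs (ee x) = 1.
Proof. by rewrite /cabs /ee /= cos2Dsin2 sqrtr1. Qed.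

Lemma ee_nat (n : nat) x : ee (n%:R * x) = ee x ^+ n.
Proof.
elim: n => [|n IH]; first by rewrite mul0r ee0.
by rewrite exprS -IH -eeD; congr ee; rewrite mulrSr; ring.
Qed.

Lemma ee_int (k : int) : ee (k%:~R : R) = 1.
Proof.
have e1 : ee (1 : R) = 1.
  by rewrite /ee mulr1 mulrC mulr_natr cos2pi sin2pi.
have en (n : nat) : ee (n%:R : R) = 1 by rewrite -[n%:R]mulr1 ee_nat e1 expr1n.
case: k => n; first exact: en.
have := en n.+1; rewrite NegzE mulrNz => h.
by rewrite -conj_ee h conjc1.
Qed.

Lemma sqr_cabs_1Bee f : cabs (1 - ee f) ^+ 2 = 2 - 2 * cos (2 * pi * f).
Proof.
rewrite sqr_cabs /= sub0r sqrrN; have := cos2Dsin2 (2 * pi * f).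
set c := cos _; set s := sin _ => h.
have -> : s ^+ 2 = 1 - c ^+ 2 by rewrite -h; ring.
ring.
Qed.

Lemma sqr_cabs_1Bee_ge f : 0 <= f <= 1 / 2 -> 8 * f ^+ 2 <= cabs (1 - ee f) ^+ 2.
Proof.
rewrite sqr_cabs_1Bee => /andP[f0 f1].
have [->|fn0] := eqVneq f 0; first by rewrite expr0n mulr0 mulr0 cos0; lra.
have {}f0 : 0 < f by rewrite lt_def fn0.
have big x : 1 / 4 <= x <= 1 / 2 -> 8 * x ^+ 2 <= 2 - 2 * cos (2 * pi * x).
  move=> /andP[x0 x1].
  have : cos (2 * pi * x) <= 0.
    have -> : 2 * pi * x = (2 * pi * x - pi) + pi :> R by ring.
    have p0 := pi_gt0 R.
    rewrite cosDpi oppr_le0; apply: cos_ge0_pihalf.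
    apply/andP; split; nra.
  nra.
(* halving the angle reduces to an angle between a quarter and a half turn *)
have halve n x : 0 < x -> x <= 1 / 2 -> 1 / 4 <= 2 ^+ n * x ->
   8 * x ^+ 2 <= 2 - 2 * cos (2 * pi * x).
  elim: n x => [|n IH] x x0 x1 hx.
    by apply: big; rewrite x1 -[x]mul1r -(expr0 2) hx.
  have [h|h] := leP (1 / 4) x; first by apply: big; rewrite h x1.
  have := IH (2 * x); rewrite mulrA -exprSr => /(_ _ _ hx) H.
  have {H} : 8 * (2 * x) ^+ 2 <= 2 - 2 * cos (2 * pi * (2 * x)) by apply: H; lra.
  have -> : 2 * pi * (2 * x) = (2 * pi * x) *+ 2 by rewrite -mulr_natl; ring.
  (* With c the cosine of the halved angle, 2 - 2 cos of the double angle is 4 (1 - c)(1 + c) <= 4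
     (2 - 2 c), which absorbs the factor 4 in (2 x)^2. *)
  rewrite cos_mulr2n; set c := cos _.
  have := cos_le1 (2 * pi * x); have := cos_geN1 (2 * pi * x); rewrite -/c.
  rewrite -mulr_natr; nra.
have [n hn] : exists n, 1 / 4 <= 2 ^+ n * f.
  exists (Num.truncn (f^-1)).+1.
  have h1 : f^-1 < (Num.truncn f^-1).+1%:R by apply: truncnS_gt.
  have h2 : ((Num.truncn f^-1).+1%:R : R) <= 2 ^+ (Num.truncn f^-1).+1.
    by rewrite -natrX ler_nat ltnW // ltn_expl.
  have := lt_le_trans h1 h2; rewrite -(ltr_pM2r f0) mulVf ?gt_eqF // => h; lra.
exact: (halve n).
Qed.

(** One-sided Dirichlet kernel. Its squared modulus is an unnormalised Fejer kernel: the coefficient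
    at frequency m is n - |m|. *)
Definition dker (n : nat) f : R[i] := \sum_(j < n) ee (j%:R * f).

Lemma dkerN n f : dker n (- f) = ((dker n f)^*)%C.
Proof.
rewrite /dker conj_sum; apply: eq_bigr => j _; by rewrite conj_ee mulrN.
Qed.

Lemma cabs_dkerN n f : cabs (dker n (- f)) = cabs (dker n f).
Proof. by rewrite dkerN cabsJ. Qed.

Lemma dker_int n f (k : int) : dker n (f + k%:~R) = dker n f.
Proof.
apply: eq_bigr => j _; rewrite mulrDr eeD.
by rewrite -[j%:R * k%:~R]/((j%:Z)%:~R * _) -intrM ee_int mulr1.
Qed.

Lemma cabs_dker_le n f : cabs (dker n f) <= n%:R.
Proof.
rewrite /dker; apply: (le_trans (cabs_sum _ _)).
by under eq_bigr do rewrite cabs_ee; rewrite sumr_const card_ord.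
Qed.

Lemma dker_geom n f : cabs (1 - ee f) * cabs (dker n f) <= 2.
Proof.
rewrite -cabsM.
have -> : (1 - ee f) * dker n f = 1 - ee f ^+ n.
  rewrite /dker; under eq_bigr do rewrite ee_nat.
  by rewrite -[1 - ee f ^+ n]opprB subrX1 -mulNr opprB.
rewrite -ee_nat; apply: (le_trans (cabsD _ _)).
by rewrite cabsN cabs_ee cabs1.
Qed.

Lemma sqr_dker_half H i f : (0 < H)%N -> 0 <= f <= 1 / 2 -> i%:R <= H%:R * f ->
  cabs (dker (2 * H) f) ^+ 2 <= 4 * H%:R ^+ 2 / i.+1%:R ^+ 2.
Proof.
move=> H0 /andP[f0 f1] hi.
have Hp : 0 < H%:R :> R by rewrite ltr0n.
have d0 := cabs_ge0 (dker (2 * H) f).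
rewrite ler_pdivlMr ?exprn_gt0 ?ltr0n //.
(* The first cell only has the trivial bound (2 H)^2. From the next one on, i + 1 <= 2 i <= 2 H f
   turns the decay in f into decay in i + 1. *)
case: i hi => [|i] hi.
  rewrite expr1n mulr1; have := cabs_dker_le (2 * H) f; rewrite natrM => ?; nra.
have h1 : 8 * f ^+ 2 <= cabs (1 - ee f) ^+ 2 by apply: sqr_cabs_1Bee_ge; rewrite f0 f1.
have := dker_geom (2 * H) f; set d := cabs (dker _ _) in d0 *.
set c := cabs (1 - _) in h1 * => h2.
have c0 : 0 <= c by apply: cabs_ge0.
have h3 : (c * d) ^+ 2 <= 4 by have : 0 <= c * d by [apply: mulr_ge0]; nra.
have h4 : 8 * f ^+ 2 * d ^+ 2 <= 4.
  by apply: le_trans h3; rewrite exprMn ler_wpM2r ?sqr_ge0.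
have h5 : (i.+2%:R : R) <= 2 * (H%:R * f).
  apply: (@le_trans _ _ (2 * i.+1%:R)); last by rewrite ler_pM2l.
  by rewrite -natrM ler_nat; lia.
have h6 : (i.+2%:R : R) ^+ 2 <= (2 * (H%:R * f)) ^+ 2.
  by rewrite ler_pXn2r // nnegrE ?ler0n // mulr_ge0 // mulr_ge0 // ltW.
apply: (@le_trans _ _ (d ^+ 2 * (2 * (H%:R * f)) ^+ 2)).
  by rewrite ler_wpM2l ?sqr_ge0.
have -> : d ^+ 2 * (2 * (H%:R * f)) ^+ 2 = (8 * f ^+ 2 * d ^+ 2) * (H%:R ^+ 2 / 2).
  by field.
have : 0 <= H%:R ^+ 2 :> R by apply: sqr_ge0.
nra.
Qed.

(** Bound for the kernel on the arc [i/H, (i+1)/H) of the circle. The two terms measure the distance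
    to 0 and to 1, both of which are the origin of the circle; adding them avoids a case distinction
    when summing. *)
Definition kap (H i : nat) : R :=
  4 * H%:R ^+ 2 * (i.+1%:R ^- 2 + (H - i)%:R ^- 2).

Lemma kap_ge0 H i : 0 <= kap H i.
Proof.
by rewrite /kap mulr_ge0 ?addr_ge0 ?mulr_ge0 ?sqr_ge0 // invr_ge0 sqr_ge0.
Qed.

Lemma sqr_dker_le H i f : (i < H)%N -> i%:R <= H%:R * f -> H%:R * f < i.+1%:R ->
  cabs (dker (2 * H) f) ^+ 2 <= kap H i.
Proof.
move=> iH hi1 hi2; have H0 : (0 < H)%N by apply: leq_ltn_trans iH.
have Hp : 0 < H%:R :> R by rewrite ltr0n.
have f0 : 0 <= f by rewrite -(pmulr_rge0 _ Hp) (le_trans _ hi1).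
have f1 : f < 1.
  rewrite -(ltr_pM2l Hp) mulr1; apply: (lt_le_trans hi2).
  by rewrite ler_nat.
have p1 : 0 <= i.+1%:R ^- 2 :> R by rewrite invr_ge0 sqr_ge0.
have p2 : 0 <= (H - i)%:R ^- 2 :> R by rewrite invr_ge0 sqr_ge0.
have p3 : 0 <= 4 * H%:R ^+ 2 :> R by rewrite mulr_ge0 // sqr_ge0.
rewrite /kap mulrDr; have [hf|hf] := leP f (1 / 2).
  have := @sqr_dker_half H i f H0; rewrite f0 hf => /(_ isT hi1) h.
  by apply: (le_trans h); rewrite lerDl mulr_ge0.
(* In the upper half the reflection 1 - f lies past (H - i - 1)/H, so the denominator becomes H -
   i. *)
have -> : cabs (dker (2 * H) f) = cabs (dker (2 * H) (1 - f)).
  have -> : 1 - f = - f + (1 : int)%:~R by rewrite addrC.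
  by rewrite dker_int cabs_dkerN.
have := @sqr_dker_half H (H - i).-1 (1 - f) H0.
have -> : ((H - i).-1.+1 = H - i)%N by rewrite prednK // subn_gt0.
have -> : (H - i).-1%:R = H%:R - i.+1%:R :> R by rewrite -natrB // subnS.
move=> h; have /h {}h : 0 <= 1 - f <= 1 / 2 by apply/andP; split; lra.
have /h {}h : H%:R - i.+1%:R <= H%:R * (1 - f) by lra.
by apply: (le_trans h); rewrite lerDr mulr_ge0.
Qed.

Lemma sum_inv_sqr n : \sum_(i < n) (i.+1%:R ^- 2 : R) <= 2.
Proof.
case: n => [|n]; first by rewrite big_ord0.
suff h : \sum_(i < n.+1) (i.+1%:R ^- 2 : R) <= 2 - n.+1%:R^-1.
  by apply: (le_trans h); rewrite lerBlDr lerDl invr_ge0 ler0n.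
elim: n => [|n IH]; first by rewrite big_ord1 expr1n invr1; lra.
rewrite big_ord_recr /=; apply: (le_trans (lerD IH (lexx _))).
have := ltr0Sn R n; rewrite -[n.+2%:R]natr1; set y := n.+1%:R => y0.
rewrite -subr_ge0.
have -> : 2 - (y + 1)^-1 - (2 - y^-1 + (y + 1) ^- 2) = y^-1 * (y + 1) ^- 2.
  by field; apply/andP; split; apply: lt0r_neq0; lra.
by rewrite mulr_ge0 ?invr_ge0 ?sqr_ge0 // ltW.
Qed.

Lemma sum_kap H : \sum_(i < H) kap H i <= 16 * H%:R ^+ 2.
Proof.
rewrite /kap -mulr_sumr big_split /=.
have -> : \sum_(i < H) ((H - i)%:R ^- 2 : R) = \sum_(i < H) i.+1%:R ^- 2.
  rewrite (reindex_inj rev_ord_inj) /=; apply: eq_bigr => i _.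
  by rewrite subKn.
have := sum_inv_sqr H; have : 0 <= H%:R ^+ 2 :> R by apply: sqr_ge0.
nra.
Qed.

End AdditiveCharacter.

Lemma ler_sum_subseq (R : realType) (I : eqType) (s1 s2 : seq I) (F : I -> R) :
  uniq s1 -> {subset s1 <= s2} -> (forall i, 0 <= F i) ->
  \sum_(i <- s1) F i <= \sum_(i <- s2) F i.
Proof.
move=> + + F0; elim: s1 s2 => [|x s1 IH] s2 /=.
  by move=> _ _; rewrite big_nil sumr_ge0.
move=> /andP[xs1 us1] sub; have xs2 : x \in s2 by apply: sub; rewrite mem_head.
rewrite big_cons (perm_big _ (perm_to_rem xs2)) big_cons lerD2l; apply: IH => //.
move=> y ys1; have := sub y; rewrite inE ys1 orbT => /(_ isT).
rewrite (perm_mem (perm_to_rem xs2)) inE => /orP[/eqP e|//].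
by rewrite e (negbTE xs1) in ys1.
Qed.

Lemma ler_sum_term (R : realType) (J : finType) (F : J -> R) j :
  (forall i, 0 <= F i) -> F j <= \sum_i F i.
Proof. by move=> F0; rewrite (bigD1 j) //= lerDl sumr_ge0. Qed.

Lemma size_le_cover (I J : eqType) (ws : seq J) (P : J -> pred I) (L : seq I) :
  {in L, forall p, exists2 w, w \in ws & P w p} ->
  (size L <= \sum_(w <- ws) size [seq p <- L | P w p])%N.
Proof.
elim: L => [//|p L IH] h /=.
have [w wws Pw] := h p (mem_head _ _).
have {}IH : (size L <= \sum_(w <- ws) size [seq p <- L | P w p])%N.
  by apply: IH => p' p'L; apply: h; rewrite inE p'L orbT.
rewrite (perm_big _ (perm_to_rem wws)) big_cons Pw /=.
rewrite (perm_big _ (perm_to_rem wws)) big_cons in IH.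
rewrite addSn ltnS; apply: (leq_trans IH); rewrite leq_add2l.
by apply: leq_sum => w' _; case: ifP.
Qed.

(** * Fejer weights on a box of frequencies *)

Section Fejer.
Context {R : realType}.

(** A difference m with |m| <= H arises from 2 H - |m| >= H pairs (j, k). The injection [phi]
    exhibits H of them: p added to the positive and to the negative part of m, for p < H. Truncated
    subtraction computes these two parts. *)
Lemma fejer_weight (H : nat) (g : int -> R) : (0 < H)%N -> (forall m, 0 <= g m) ->
  H%:R * \sum_(i < (2 * H).+1) g (i%:Z - H%:Z) <=
  \sum_(j < 2 * H) \sum_(k < 2 * H) g (j%:Z - k%:Z).
Proof.
case: H => // h _ g0; set H := h.+1.
have e2 : (2 * H = (2 * h).+2)%N by rewrite /H; lia.
rewrite e2.
pose G (x : 'I_(2 * h).+2 * 'I_(2 * h).+2) := g (x.1%:Z - x.2%:Z).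
pose phi (x : 'I_H * 'I_(2 * h).+3) : 'I_(2 * h).+2 * 'I_(2 * h).+2 :=
  (inord (x.1 + (x.2 - H)), inord (x.1 + (H - x.2)))%N.
have v1 x : (phi x).1 = (x.1 + (x.2 - H))%N :> nat.
  rewrite /phi /= inordK //; have := ltn_ord x.1; have := ltn_ord x.2.
  rewrite /H; lia.
have v2 x : (phi x).2 = (x.1 + (H - x.2))%N :> nat.
  rewrite /phi /= inordK //; have := ltn_ord x.1; have := ltn_ord x.2.
  rewrite /H; lia.
have phi_inj : injective phi.
  move=> [p i] [q j] e.
  have := v1 (p, i); have := v2 (p, i); rewrite e v1 v2 /= => e1 e2'.
  by congr pair; apply: ord_inj; lia.
rewrite [leRHS]pair_big /= -/G.
have -> : H%:R * \sum_(i < (2 * h).+3) g (i%:Z - H%:Z) =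
    \sum_(x : 'I_H * 'I_(2 * h).+3) G (phi x).
  transitivity (\sum_(p < H) \sum_(i < (2 * h).+3) g (i%:Z - H%:Z)).
    by rewrite sumr_const card_ord mulr_natl.
  rewrite pair_big /=; apply: eq_bigr => x _; rewrite /G v1 v2; congr g; lia.
rewrite -(big_imset G) /=; last by move=> ? ? _ _; apply: phi_inj.
rewrite [leRHS](bigID (mem (phi @: predT))) /= lerDl.
by apply: sumr_ge0 => x _; apply: g0.
Qed.

Lemma fejer_weight2 (H : nat) (F : int -> int -> R) : (0 < H)%N ->
  (forall m n, 0 <= F m n) ->
  H%:R ^+ 2 * \sum_(i < (2 * H).+1) \sum_(l < (2 * H).+1)
     F (i%:Z - H%:Z) (l%:Z - H%:Z) <=
  \sum_(j < 2 * H) \sum_(k < 2 * H) \sum_(j' < 2 * H) \sum_(k' < 2 * H)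
     F (j%:Z - k%:Z) (j'%:Z - k'%:Z).
Proof.
move=> H0 F0.
have h1 := @fejer_weight H (fun m => \sum_(l < (2 * H).+1) F m (l%:Z - H%:Z)) H0
  (fun m => sumr_ge0 _ (fun l _ => F0 _ _)).
rewrite expr2 -mulrA; apply: (le_trans (ler_wpM2l (ler0n _ _) h1)).
rewrite mulr_sumr; apply: ler_sum => j _; rewrite mulr_sumr; apply: ler_sum => k _.
exact: fejer_weight.
Qed.

Lemma dker_sqr n (f : R) :
  ((cabs (dker n f) ^+ 2)%:C)%C =
  \sum_(j < n) \sum_(k < n) ee ((j%:Z - k%:Z)%:~R * f).
Proof.
rewrite sqr_cabsC /dker conj_sum mulr_suml; apply: eq_bigr => j _.
rewrite mulr_sumr; apply: eq_bigr => k _.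
by rewrite conj_ee -eeD rmorphB /= mulrBl.
Qed.

End Fejer.

Lemma mem_gbox (M : nat) (n : gi) :
  (n \in gbox M) = (`|n.1| <= M%:Z) && (`|n.2| <= M%:Z).
Proof.
apply/allpairsP/andP => [[[i j] []]|[h1 h2]].
  by rewrite !mem_iota => hi hj ->; rewrite /= in hi hj *; split; lia.
case: n h1 h2 => u v h1 h2; rewrite /= in h1 h2.
exists (absz (u + M%:Z), absz (v + M%:Z)); rewrite !mem_iota /=.
by split; [lia | lia |]; congr pair; lia.
Qed.

Lemma uniq_gbox M : uniq (gbox M).
Proof.
apply: allpairs_uniq; rewrite ?iota_uniq // => -[i j] [k l] _ _ /= [e1 e2].
by congr pair; lia.
Qed.

(** * Schur's test and duality *)

Section LargeSieve.
Context {R : realType} (I : eqType) (L : seq I) (x y : I -> R) (H : nat).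
Hypothesis H_gt0 : (0 < H)%N.

(** Distance on the circle R/Z at most half the length of one of H equal arcs, so that [hK] bounds
    the number of points in any square of side 1/H on the torus. *)
Definition near1 (f al : R) : bool :=
  `[< exists k : int, `|f - al - k%:~R| <= (2 * H%:R)^-1 >].

Variable K : R.
Hypothesis K_gt0 : 0 < K.
Hypothesis hK : forall al be,
  (count (fun s => near1 (x s) al && near1 (y s) be) L)%:R <= K.

Definition wker r s : R :=
  cabs (dker (2 * H) (x r - x s)) ^+ 2 * cabs (dker (2 * H) (y r - y s)) ^+ 2.

Definition frac1 (f : R) : R := f - (Num.floor f)%:~R.

Lemma frac1_itv f : 0 <= frac1 f < 1.
Proof. by have := floor_itv f; rewrite /frac1 intrD => ?; lra. Qed.

Definition cell (f : R) : nat := Num.truncn (H%:R * frac1 f).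

Let HR_gt0 : 0 < H%:R :> R. Proof. by rewrite ltr0n. Qed.

Lemma cell_itv f : (cell f)%:R <= H%:R * frac1 f < (cell f).+1%:R.
Proof.
apply: truncn_itv; rewrite pmulr_rge0 //; by case/andP: (frac1_itv f).
Qed.

Lemma cell_lt f : (cell f < H)%N.
Proof.
have /andP[h _] := cell_itv f; have /andP[_ h'] := frac1_itv f.
by rewrite -(ltr_nat R); apply: (le_lt_trans h); rewrite gtr_pMr.
Qed.

(** The shift added to g is the midpoint of the arc that contains f - g modulo 1. *)
Lemma near1_cell f g : near1 f (g + (2 * (cell (f - g))%:R + 1) / (2 * H%:R)).
Proof.
apply/asboolP; exists (Num.floor (f - g)).
have /andP[h1 h2] := cell_itv (f - g); set i := (cell _)%:R in h1 *.
move: h1 h2; rewrite -natr1 -/i /frac1; set k := (_)%:~R => h1 h2.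
have -> : f - (g + (2 * i + 1) / (2 * H%:R)) - k =
    (2 * (H%:R * (f - g - k)) - (2 * i + 1)) / (2 * H%:R).
  by field; apply: lt0r_neq0.
rewrite normrM [`|(_)^-1|]ger0_norm; last by rewrite invr_ge0 mulr_ge0 // ltW.
rewrite ler_piMl ?invr_ge0 ?mulr_ge0 ?(ltW HR_gt0) // ler_norml.
apply/andP; split; lra.
Qed.

Lemma sqr_dker_cell f : cabs (dker (2 * H) f) ^+ 2 <= kap H (cell f).
Proof.
have /andP[h1 h2] := cell_itv f.
rewrite -(subrK (Num.floor f)%:~R f) dker_int subrK.
exact: sqr_dker_le (cell_lt f) h1 h2.
Qed.

(** The torus is cut into H^2 squares around the point r. Each holds at most K points, and on square
    (i, j) the kernel is at most [kap H i * kap H j]; the double sum factors into two sums of at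
    most 16 H^2. *)
Lemma wker_row r : \sum_(s <- L) wker r s <= 256 * H%:R ^+ 4 * K.
Proof.
pose al (i : 'I_H) := x r + (2 * i%:R + 1) / (2 * H%:R).
pose be (i : 'I_H) := y r + (2 * i%:R + 1) / (2 * H%:R).
pose P (i j : 'I_H) s := near1 (x s) (al i) && near1 (y s) (be j).
have kk0 (i j : 'I_H) : 0 <= kap H i * kap H j :> R by rewrite mulr_ge0 ?kap_ge0.
have h s : wker r s <=
    \sum_(i < H) \sum_(j < H) (P i j s)%:R * (kap H i * kap H j).
  pose i0 := Ordinal (cell_lt (x s - x r)); pose j0 := Ordinal (cell_lt (y s - y r)).
  apply: (@le_trans _ _ ((P i0 j0 s)%:R * (kap H i0 * kap H j0))).
    rewrite /P !near1_cell mul1r /wker -opprB cabs_dkerN -[y r - y s]opprB cabs_dkerN.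
    by rewrite ler_pM ?sqr_ge0 // sqr_dker_cell.
  apply: (le_trans (@ler_sum_term R _ (fun j => (P i0 j s)%:R * (kap H i0 * kap H j)) j0 _)).
    by move=> j; rewrite mulr_ge0.
  apply: (@ler_sum_term R _ (fun i => \sum_(j < H) (P i j s)%:R * (kap H i * kap H j))).
  by move=> i; apply: sumr_ge0 => j _; rewrite mulr_ge0.
apply: (le_trans (ler_sum _ (fun s _ => h s))).
rewrite exchange_big /=.
apply: (@le_trans _ _ (\sum_(i < H) \sum_(j < H) K * (kap H i * kap H j))).
  apply: ler_sum => i _; rewrite exchange_big /=; apply: ler_sum => j _.
  rewrite -mulr_suml ler_wpM2r //; apply: le_trans (hK (al i) (be j)).
  by rewrite -sum1_count natr_sum [leRHS]big_mkcond /=; apply: ler_sum => s _; rewrite /P; case: ifP.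
have -> : \sum_(i < H) \sum_(j < H) K * (kap H i * kap H j) =
   K * ((\sum_(i < H) kap H i) * (\sum_(j < H) kap H j)).
  rewrite mulr_suml mulr_sumr; apply: eq_bigr => i _.
  by rewrite !mulr_sumr.
have -> : 256 * H%:R ^+ 4 * K = K * ((16 * H%:R ^+ 2) * (16 * H%:R ^+ 2)) by ring.
rewrite ler_wpM2l ?(ltW K_gt0) // ler_pM ?sum_kap //;
  by apply: sumr_ge0 => i _; apply: kap_ge0.
Qed.

Lemma wker_ge0 r s : 0 <= wker r s.
Proof. by rewrite mulr_ge0 ?sqr_ge0. Qed.

Lemma wkerC r s : wker r s = wker s r.
Proof. by rewrite /wker -opprB cabs_dkerN -[y r - y s]opprB cabs_dkerN. Qed.

Lemma schur_test (b : I -> R) :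
  \sum_(r <- L) \sum_(s <- L) b r * b s * wker r s <=
  256 * H%:R ^+ 4 * K * \sum_(r <- L) b r ^+ 2.
Proof.
pose A := \sum_(r <- L) \sum_(s <- L) b r ^+ 2 / 2 * wker r s.
have hA : A <= 256 * H%:R ^+ 4 * K * (\sum_(r <- L) b r ^+ 2) / 2.
  rewrite /A -mulrA mulr_suml mulr_sumr; apply: ler_sum => r _.
  by rewrite -mulr_sumr mulrC ler_wpM2r ?wker_row // divr_ge0 ?sqr_ge0.
have eA : A = \sum_(r <- L) \sum_(s <- L) b s ^+ 2 / 2 * wker r s.
  by rewrite exchange_big; do 2![apply: eq_bigr => ? _]; rewrite wkerC.
apply: (@le_trans _ _ (A + A)); last by lra.
rewrite {2}eA /A -big_split; apply: ler_sum => r _.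
rewrite -big_split; apply: ler_sum => s _ /=.
rewrite -mulrDl ler_wpM2r ?wker_ge0 //.
have := sqr_ge0 (b r - b s); nra.
Qed.

Definition dual_form (c : I -> R[i]) (m n : int) : R[i] :=
  \sum_(s <- L) c s * ee (m%:~R * x s + n%:~R * y s).

Lemma dual_form_sqr c m n : ((cabs (dual_form c m n) ^+ 2)%:C)%C =
  \sum_(r <- L) \sum_(s <- L) c r * ((c s)^*)%C *
    (ee (m%:~R * (x r - x s)) * ee (n%:~R * (y r - y s))).
Proof.
rewrite sqr_cabsC /dual_form conj_sum mulr_suml; apply: eq_bigr => r _.
rewrite mulr_sumr; apply: eq_bigr => s _.
rewrite conjM conj_ee mulrACA -!eeD; congr (_ * ee _); ring.
Qed.

Lemma dual_form_fejer c :
  ((\sum_(j < 2 * H) \sum_(k < 2 * H) \sum_(j' < 2 * H) \sum_(k' < 2 * H)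
     cabs (dual_form c (j%:Z - k%:Z) (j'%:Z - k'%:Z)) ^+ 2)%:C)%C =
  \sum_(r <- L) \sum_(s <- L) c r * ((c s)^*)%C * ((wker r s)%:C)%C.
Proof.
transitivity (\sum_(r <- L) \sum_(s <- L)
   \sum_(j < 2 * H) \sum_(k < 2 * H) \sum_(j' < 2 * H) \sum_(k' < 2 * H)
   c r * ((c s)^*)%C * (ee ((j%:Z - k%:Z)%:~R * (x r - x s)) *
     ee ((j'%:Z - k'%:Z)%:~R * (y r - y s)))); last first.
  apply: eq_bigr => r _; apply: eq_bigr => s _.
  rewrite /wker (rmorphM (real_complex R)) /= !dker_sqr mulr_suml mulr_sumr.
  apply: eq_bigr => j _; rewrite mulr_suml mulr_sumr; apply: eq_bigr => k _.
  rewrite !mulr_sumr; apply: eq_bigr => j' _.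
  by rewrite !mulr_sumr.
have exch (F : I -> 'I_(2 * H) -> 'I_(2 * H) -> 'I_(2 * H) -> 'I_(2 * H) -> R[i]) :
    \sum_(r <- L) \sum_j \sum_k \sum_j' \sum_k' F r j k j' k' =
    \sum_j \sum_k \sum_j' \sum_k' \sum_(r <- L) F r j k j' k'.
  rewrite exchange_big; apply: eq_bigr => j _.
  rewrite exchange_big; apply: eq_bigr => k _.
  by rewrite exchange_big; apply: eq_bigr => j' _; rewrite exchange_big.
under [RHS]eq_bigr do rewrite exch; rewrite exch.
rewrite rcsum; apply: eq_bigr => j _; rewrite rcsum; apply: eq_bigr => k _.
rewrite rcsum; apply: eq_bigr => j' _; rewrite rcsum; apply: eq_bigr => k' _.
exact: dual_form_sqr.
Qed.

(** The Fejer weight is at least H^2 on the box, while the weighted form costs H^4 by Schur's test;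
    the quotient leaves H^2. Moduli may be taken inside because the kernel is nonnegative. *)
Lemma dual_large_sieve c :
  \sum_(i < (2 * H).+1) \sum_(l < (2 * H).+1)
     cabs (dual_form c (i%:Z - H%:Z) (l%:Z - H%:Z)) ^+ 2 <=
  256 * H%:R ^+ 2 * K * \sum_(s <- L) cabs (c s) ^+ 2.
Proof.
have H2 : 0 < H%:R ^+ 2 :> R by rewrite exprn_gt0.
rewrite -(ler_pM2l H2).
apply: (le_trans (@fejer_weight2 _ _ (fun m n => cabs (dual_form c m n) ^+ 2) H_gt0
   (fun m n => sqr_ge0 _))).
set T := \sum_(j < _) _.
have T0 : 0 <= T by do 4![apply: sumr_ge0 => ? _]; apply: sqr_ge0.
rewrite -(cabs_real T0) /T dual_form_fejer.
apply: (le_trans (cabs_sum _ _)).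
have -> : H%:R ^+ 2 * (256 * H%:R ^+ 2 * K * \sum_(s <- L) cabs (c s) ^+ 2) =
   256 * H%:R ^+ 4 * K * \sum_(s <- L) cabs (c s) ^+ 2 by ring.
apply: le_trans (schur_test _); apply: ler_sum => r _.
apply: (le_trans (cabs_sum _ _)); apply: ler_sum => s _.
by rewrite !cabsM cabsJ cabs_real ?wker_ge0.
Qed.

(** Duality carried out by hand: the dual form with coefficients conj(T s) turns the left-hand side
    X into the sum of a(n) B(n), and the dual inequality bounds the sum of |B(n)|^2 by Lam X. *)
Lemma large_sieve (ns : seq gi) (a : gi -> R[i]) : uniq ns ->
  {in ns, forall n, (`|n.1| <= H%:Z) && (`|n.2| <= H%:Z)} ->
  \sum_(s <- L) cabs (\sum_(n <- ns) a n * ee (n.1%:~R * x s + n.2%:~R * y s)) ^+ 2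
  <= 256 * H%:R ^+ 2 * K * \sum_(n <- ns) cabs (a n) ^+ 2.
Proof.
move=> uns hns; set Lam := 256 * _ * K.
have Lam0 : 0 < Lam by rewrite /Lam !mulr_gt0.
pose T s := \sum_(n <- ns) a n * ee (n.1%:~R * x s + n.2%:~R * y s).
pose B n := dual_form (fun s => ((T s)^*)%C) n.1 n.2.
set X := \sum_(s <- L) _.
have X0 : 0 <= X by apply: sumr_ge0 => s _; apply: sqr_ge0.
have eX : (X%:C)%C = \sum_(n <- ns) a n * B n.
  rewrite /X rcsum; under eq_bigr do rewrite sqr_cabsC -/(T _) mulr_suml.
  rewrite exchange_big /=; apply: eq_bigr => n _; rewrite /B /dual_form mulr_sumr.
  by apply: eq_bigr => s _; rewrite -mulrA; congr (_ * _); rewrite mulrC.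
have hB : \sum_(n <- ns) cabs (B n) ^+ 2 <= Lam * X.
  have -> : X = \sum_(s <- L) cabs ((T s)^*)%C ^+ 2.
    by apply: eq_bigr => s _; rewrite cabsJ.
  apply: le_trans (dual_large_sieve _).
  have sub : {subset ns <= gbox H} by move=> n /hns; rewrite mem_gbox.
  apply: (le_trans (ler_sum_subseq uns sub _)) => [n|]; first exact: sqr_ge0.
  rewrite /gbox big_allpairs_dep -[iota 0 (2 * H).+1]/(index_iota 0 (2 * H).+1) big_mkord.
  by apply: ler_sum => i _; rewrite big_mkord.
have h1 : X <= \sum_(n <- ns) cabs (a n) * cabs (B n).
  rewrite -(cabs_real X0) eX; apply: (le_trans (cabs_sum _ _)).
  by under eq_bigr do rewrite cabsM.
(* AM-GM: [2 |a| |B| <= Lam |a|^2 + |B|^2 / Lam] *)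
have h2 : X <= (Lam * \sum_(n <- ns) cabs (a n) ^+ 2 +
    (\sum_(n <- ns) cabs (B n) ^+ 2) / Lam) / 2.
  apply: (le_trans h1); rewrite mulr_sumr mulr_suml -big_split mulr_suml /=.
  apply: ler_sum => n _; set u := cabs _; set v := cabs _.
  rewrite -subr_ge0.
  have -> : (Lam * u ^+ 2 + v ^+ 2 / Lam) / 2 - u * v = (Lam * u - v) ^+ 2 / (2 * Lam).
    by field; apply: lt0r_neq0.
  by rewrite divr_ge0 ?sqr_ge0 // mulr_ge0 // ltW.
(* With Lam as the weight in AM-GM, the B-part is at most X, so X <= (Lam Z + X) / 2 and half of X
   is absorbed, Z being the sum of |a(n)|^2. *)
have h3 : (\sum_(n <- ns) cabs (B n) ^+ 2) / Lam <= X.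
  by rewrite ler_pdivrMr // mulrC.
lra.
Qed.

End LargeSieve.

(** * Dirichlet approximation in Z[i] *)

Section GaussianEmbedding.
Context {R : realType}.
Implicit Types q : gi.
Local Notation gtoC := (@gtoC R).
Local Notation gabs := (@gabs R).

Lemma gtoCM q q' : gtoC (gmul q q') = gtoC q * gtoC q'.
Proof.
apply/eqP; rewrite eq_complex /= !rmorphD !rmorphN !rmorphM /=.
by apply/andP; split; apply/eqP; ring.
Qed.

Lemma gtoCB q q' : gtoC (gsub q q') = gtoC q - gtoC q'.
Proof. by apply/eqP; rewrite eq_complex /= !rmorphB !eqxx. Qed.

Lemma sqr_gabs q : gabs q ^+ 2 = (gnorm q)%:~R.
Proof. by rewrite sqr_cabs /= /gnorm rmorphD !rmorphXn. Qed.

Lemma gabs_ge0 q : 0 <= gabs q. Proof. exact: cabs_ge0. Qed.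

Lemma gabsM q q' : gabs (gmul q q') = gabs q * gabs q'.
Proof. by rewrite /Defs.gabs gtoCM cabsM. Qed.

Lemma gabs_ge1 q : q != (0, 0) -> 1 <= gabs q.
Proof.
move=> q0; rewrite -(@ler_pXn2r _ 2) ?nnegrE ?gabs_ge0 // expr1n sqr_gabs.
by rewrite ler1z -gtz0_ge1 gnorm_gt0.
Qed.

Lemma gabs_gt0 q : q != (0, 0) -> 0 < gabs q.
Proof. by move=> /gabs_ge1; apply: lt_le_trans. Qed.

Lemma gtoC_eq0 q : (gtoC q == 0) = (q == (0, 0)).
Proof.
by rewrite -cabs_eq0 -/(gabs q) -sqrf_eq0 sqr_gabs intr_eq0 gnorm_eq0.
Qed.

(** There are M^2 multipliers and M^2 boxes, so a collision is not forced. Without one, the box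
    assignment is a bijection, and the multiplier landing in a box adjacent to the origin serves by
    itself. This keeps the coordinates of r within m = M - 1. *)
Lemma dirichlet_pigeonhole (al : R[i]) (m : nat) : exists r b : gi,
  [/\ r != (0, 0), gabs r ^+ 2 <= Num.max 1 (2 * m%:R ^+ 2) &
      cabs (gtoC r * al - gtoC b) ^+ 2 <= 2 / m.+1%:R ^+ 2].
Proof.
set M := m.+1; have eM : M = m.+1 by []; have M0 : 0 < M%:R :> R by rewrite ltr0n.
pose u (r : gi) := complex.Re (gtoC r * al).
pose v (r : gi) := complex.Im (gtoC r * al).
have uB r r' : u (gsub r r') = u r - u r' by rewrite /u gtoCB mulrBl raddfB.
have vB r r' : v (gsub r r') = v r - v r' by rewrite /v gtoCB mulrBl raddfB.
(* Rounding up here and down below makes box (1, 0) touch the origin without containing it: there M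
   u lies in (0, 1] and M v in [0, 1) modulo M, while the multiplier 0 falls in box (0, 0). *)
pose p r : int := Num.ceil (M%:R * u r).
pose s r : int := Num.floor (M%:R * v r).
have hp r : (p r)%:~R - 1 < M%:R * u r <= (p r)%:~R.
  by have := ceil_itv (M%:R * u r); rewrite -/(p r) rmorphB.
have hs r : (s r)%:~R <= M%:R * v r < (s r)%:~R + 1.
  by have := floor_itv (M%:R * v r); rewrite -/(s r) rmorphD.
have close r k l : `|M%:R * u r - M%:R * k%:~R| <= 1 ->
    `|M%:R * v r - M%:R * l%:~R| <= 1 ->
    cabs (gtoC r * al - gtoC (k, l)) ^+ 2 <= 2 / M%:R ^+ 2.
  have -> : cabs (gtoC r * al - gtoC (k, l)) ^+ 2 =
     (u r - k%:~R) ^+ 2 + (v r - l%:~R) ^+ 2.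
    by rewrite sqr_cabs /u /v; case: (gtoC r * al).
  rewrite -!mulrBr !normrM !(ger0_norm (ltW M0)) => h1 h2.
  rewrite ler_pdivlMr ?exprn_gt0 // mulrDl -!exprMn.
  have sq (a : R) : M%:R * `|a| <= 1 -> (a * M%:R) ^+ 2 <= 1.
    move=> h; rewrite -[_ ^+ 2]ger0_norm ?sqr_ge0 // normrX normrM mulrC.
    rewrite (ger0_norm (ltW M0)); apply: exprn_ile1 => //.
    by rewrite mulr_ge0 // ltW.
  have := sq _ h1; have := sq _ h2; lra.
pose emb (x : 'I_M * 'I_M) : gi := (x.1%:Z, x.2%:Z).
have embP (n : gi) : `|n.1| <= m%:Z -> `|n.2| <= m%:Z ->
    gabs n ^+ 2 <= Num.max 1 (2 * m%:R ^+ 2).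
  move=> h1 h2; rewrite le_max; apply/orP; right; rewrite sqr_gabs.
  have -> : 2 * m%:R ^+ 2 = (2 * m%:Z ^+ 2)%:~R :> R by rewrite rmorphM rmorphXn.
  have sq (z : int) : `|z| <= m%:Z -> z ^+ 2 <= m%:Z ^+ 2.
    by rewrite ler_norml => /andP[? ?]; nia.
  rewrite ler_int /gnorm; have := sq _ h1; have := sq _ h2; lia.
have ordN (i : 'I_M) : `|i%:Z| <= m%:Z by have := ltn_ord i; lia.
have ordB (i j : 'I_M) : `|i%:Z - j%:Z| <= m%:Z.
  by have := ltn_ord i; have := ltn_ord j; lia.
pose rs (z : int) : 'I_M := inord (absz (z %% M%:Z)%Z).
have rsP z : (rs z)%:Z = (z %% M%:Z)%Z.
  have h0 : 0 <= (z %% M%:Z)%Z by apply: modz_ge0.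
  have h1 : (z %% M%:Z)%Z < M%:Z by apply: ltz_pmod.
  by rewrite /rs inordK; lia.
pose f (x : 'I_M * 'I_M) := (rs (p (emb x)), rs (s (emb x))).
have [/injectiveP finj|/injectivePn [x [x' xx' e]]] := boolP (injectiveb f); last first.
  pose r := gsub (emb x) (emb x').
  have [k ek] : exists k, p (emb x) - p (emb x') = k * M%:Z.
    have : (p (emb x) %% M%:Z)%Z = (p (emb x') %% M%:Z)%Z by rewrite -!rsP; case: e => ->.
    by move/eqP; rewrite eqz_mod_dvd => /dvdzP.
  have [l el] : exists l, s (emb x) - s (emb x') = l * M%:Z.
    have : (s (emb x) %% M%:Z)%Z = (s (emb x') %% M%:Z)%Z by rewrite -!rsP; case: e => _ ->.
    by move/eqP; rewrite eqz_mod_dvd => /dvdzP.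
  exists r, (k, l); split.
  - apply: contraNneq xx' => /gsub_eq0 [e1 e2]; apply/eqP.
    by case: x x' {e r ek el} e1 e2 => [a b] [c d] /= ? ?; congr pair; apply: val_inj.
  - by apply: embP; rewrite /r /emb /gsub /=; apply: ordB.
  - have := hp (emb x); have := hp (emb x'); have := hs (emb x); have := hs (emb x').
    have := congr1 (fun z : int => z%:~R : R) ek.
    have := congr1 (fun z : int => z%:~R : R) el.
    rewrite !rmorphB !rmorphM /= -[(M%:Z)%:~R]/(M%:R) => e1 e2.
    move=> /andP[? ?] /andP[? ?] /andP[? ?] /andP[? ?].
    by apply: close; rewrite ?uB ?vB ler_norml; apply/andP; split; lra.
have conclude r : (p r = 1 %[mod M%:Z])%Z -> (s r = 0 %[mod M%:Z])%Z ->
    exists b, cabs (gtoC r * al - gtoC b) ^+ 2 <= 2 / M%:R ^+ 2.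
  move=> /eqP; rewrite eqz_mod_dvd => /dvdzP [k ek].
  move=> /eqP; rewrite eqz_mod_dvd => /dvdzP [l el].
  exists (k, l).
  have := hp r; have := hs r.
  have := congr1 (fun z : int => z%:~R : R) ek.
  have := congr1 (fun z : int => z%:~R : R) el.
  rewrite !rmorphB !rmorphM /= -[(M%:Z)%:~R]/(M%:R) => e1 e2.
  move=> /andP[? ?] /andP[? ?].
  by apply: close; rewrite ler_norml; apply/andP; split; lra.
(* For M = 1 the boxes (1, 0) and (0, 0) coincide, so r = 1 is taken instead; this is the source of
   the 1 in the maximum. *)
have [m0|m0] := eqVneq m 0%N.
  have [|| b hb] := conclude (1, 0); rewrite /M ?m0 ?modz1 //.
  exists (1, 0), b; split => //; rewrite ?le_max ?sqr_gabs /gnorm /=; last first.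
    by move: hb; rewrite /M m0.
  by rewrite expr1n expr0n addr0 lexx.
have [g fg gf] : bijective f by apply: injF_bij.
pose x := g (rs 1, rs 0).
have [e1 e2] : rs (p (emb x)) = rs 1 /\ rs (s (emb x)) = rs 0.
  by have := gf (rs 1, rs 0); rewrite -/x /f => -[-> ->].
have [|| b hb] := conclude (emb x); rewrite -?rsP ?e1 ?e2 //.
exists (emb x), b; split => //.
  apply/eqP => ex0; move: e1; rewrite ex0 /p /u.
  have -> : gtoC (0, 0) = 0 by apply/eqP; rewrite gtoC_eq0.
  rewrite mul0r /= mulr0 ceil0 => /(congr1 (fun z : 'I_M => z%:Z)).
  by rewrite !rsP mod0z modz_small // /M; lia.
by apply: embP; rewrite /emb /=; apply: ordN.
Qed.

Lemma dirichlet_gi (al : R[i]) (tau : R) : 1 <= tau -> exists r b : gi,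
  [/\ r != (0, 0), gcoprime b r, gabs r <= tau &
      cabs (gtoC r * al - gtoC b) <= 2 / tau].
Proof.
move=> tau1; have tau0 : 0 < tau by lra.
(* With m the integer part of tau / sqrt 2, the bound sqrt 2 m on |r| is at most tau, and the error
   sqrt 2 / (m + 1) is at most 2 / tau. *)
pose s : R := Num.sqrt (tau ^+ 2 / 2).
have s0 : 0 <= s by apply: sqrtr_ge0.
have s2 : s ^+ 2 = tau ^+ 2 / 2 by rewrite sqr_sqrtr // divr_ge0 ?sqr_ge0.
have /andP[hm1 hm2] := truncn_itv s0; set m := Num.truncn s in hm1 hm2.
have [r [b [r0 hr hb]]] := dirichlet_pigeonhole al m.
have {}hr : gabs r <= tau.
  rewrite -(@ler_pXn2r _ 2) ?nnegrE ?gabs_ge0 ?(ltW tau0) //.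
  apply: (le_trans hr); rewrite ge_max; apply/andP; split; first by nra.
  have : m%:R ^+ 2 <= s ^+ 2 :> R by rewrite ler_pXn2r ?nnegrE.
  by rewrite s2; lra.
have {}hb : cabs (gtoC r * al - gtoC b) <= 2 / tau.
  rewrite -(@ler_pXn2r _ 2) ?nnegrE ?cabs_ge0 ?divr_ge0 ?(ltW tau0) //.
  apply: (le_trans hb).
  have h : s ^+ 2 <= m.+1%:R ^+ 2 by rewrite ler_pXn2r ?nnegrE // ltW.
  rewrite exprMn exprVn ler_pdivrMr ?exprn_gt0 ?ltr0n //.
  have -> : 2 ^+ 2 / tau ^+ 2 * m.+1%:R ^+ 2 = (4 * m.+1%:R ^+ 2) / tau ^+ 2 by ring.
  by rewrite ler_pdivlMr ?exprn_gt0 //; lra.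
have [g [x [y [gb gr e]]]] := gbezout b r.
have [b' eb] := gb; have [r' er] := gr.
have g0 : g != (0, 0) by apply: contra_neq r0 => g0; rewrite er g0 gmulC gmul0.
have r'0 : r' != (0, 0) by apply: contra_neq r0 => r'0; rewrite er r'0 gmul0.
have g1 := gabs_ge1 g0.
exists r', b'; split => //.
- apply: (@bezout_gcoprime _ _ x y); apply: (@gmulI g) => //.
  by rewrite gmul1 gmulDr !gmulA -eb -er.
- apply: le_trans hr; rewrite er gabsM ler_peMl ?gabs_ge0 //.
- apply: le_trans hb; rewrite er eb !gtoCM -mulrA -mulrBr cabsM.
  by rewrite ler_peMl ?cabs_ge0.
Qed.

End GaussianEmbedding.

(** * Counting Farey fractions in small discs *)

Section BoundedSup.
Context {R : realType} (Q N : nat) (S : seq gi) (ds : gi -> seq gi).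
Local Notation gtoC := (@gtoC R).
Local Notation gabs := (@gabs R).
Hypothesis N_gt0 : (0 < N)%N.
Hypothesis uniqS : uniq S.
Hypothesis dsP : forall r, r != (0, 0) -> is_divsys r (ds r).

Lemma mem_gball (y : R[i]) (u : R) q :
  (q \in gball_seq y u) = (cabs (gtoC q - y) <= u).
Proof.
rewrite mem_filter; case: leP => //= h.
have hq : gabs q <= cabs y + u.
  by rewrite /Defs.gabs -(subrK y (gtoC q)) addrC; apply: (le_trans (cabsD _ _)); rewrite lerD2l.
have u0 : 0 <= cabs y + u by apply: le_trans hq; apply: gabs_ge0.
have small (c : int) : c ^+ 2 <= gnorm q -> `|c| <= (Num.truncn (cabs y + u))%:Z.
  move=> hc; have : `|c|%:~R <= gabs q.
    rewrite -(@ler_pXn2r _ 2) ?nnegrE ?gabs_ge0 ?ler0z //.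
    by rewrite sqr_gabs -rmorphXn ler_int real_normK // num_real.
  move=> /le_trans /(_ hq).
  by rewrite -[`|c|]abszE -pmulrn -truncn_ge_nat.
have s1 := sqr_ge0 q.1; have s2 := sqr_ge0 q.2.
by rewrite mem_gbox !small // /gnorm ?lerDl ?lerDr.
Qed.

Lemma uniq_gball (y : R[i]) (u : R) : uniq (gball_seq y u).
Proof. by rewrite filter_uniq // uniq_gbox. Qed.

Lemma Acount_le t (u : R) k l y : t != (0, 0) -> (Acount S t u k l y <= size S)%N.
Proof.
move=> t0; rewrite /Acount -size_filter -(size_map (gmul t)).
apply: uniq_leq_size.
  rewrite map_inj_uniq; first by rewrite filter_uniq // uniq_gball.
  by move=> q q'; apply: gmulI.
by move=> _ /mapP[q + ->]; rewrite mem_filter => /andP[/andP[? _] _].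
Qed.

(** Multiplication by t embeds the counted points in S, so [size S] bounds every count. Only with
    such a bound does [sup] dominate the members of the set. *)
Lemma A_t_has_ubound t (u : R) k l : t != (0, 0) ->
  has_ubound [set x : R | exists y : R[i],
         cabs y <= Num.sqrt (Q%:R) / gabs t /\ x = (Acount S t u k l y)%:R].
Proof.
move=> t0; exists (size S)%:R => _ [y [_ ->]]; by rewrite ler_nat Acount_le.
Qed.

Lemma Acount_le_A_t t (u : R) k l y : t != (0, 0) ->
  cabs y <= Num.sqrt (Q%:R) / gabs t -> (Acount S t u k l y)%:R <= A_t Q S t u k l.
Proof.
by move=> t0 hy; apply: ub_le_sup; [apply: A_t_has_ubound | exists y].
Qed.

Let origin_ok t : cabs (0 : R[i]) <= Num.sqrt (Q%:R) / gabs t.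
Proof. by rewrite cabs0 divr_ge0 ?sqrtr_ge0 ?gabs_ge0. Qed.

Lemma A_t_ge0 t (u : R) k l : t != (0, 0) -> 0 <= A_t Q S t u k l.
Proof. by move=> t0; apply: le_trans (Acount_le_A_t _ _ _ t0 (origin_ok t)). Qed.

Lemma A_t_le t (u : R) k l : t != (0, 0) -> A_t Q S t u k l <= (size S)%:R.
Proof.
move=> t0; apply: sup_le_ub; first by exists (Acount S t u k l 0)%:R, 0.
by move=> _ [y [_ ->]]; rewrite ler_nat Acount_le.
Qed.

Lemma divsys_neq0 r t : r != (0, 0) -> t \in ds r -> t != (0, 0).
Proof.
move=> r0 /(proj1 (proj2 (dsP r0))) [k e].
by apply: contra_neq r0 => t0; rewrite e t0 gmulC gmul0.
Qed.

Lemma inner_sum_ge0 r (z : R[i]) h : r != (0, 0) -> 0 <= inner_sum Q N S ds r z h.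
Proof.
move=> r0; rewrite /inner_sum big_seq; apply: sumr_ge0 => t ht.
by apply: sumr_ge0 => m _; apply/A_t_ge0/(divsys_neq0 r0 ht).
Qed.

Let tau : R := Num.sqrt (Num.sqrt (N%:R)).

Lemma tau_ge1 : 1 <= tau.
Proof.
rewrite -sqrtr1 ler_wsqrtr // -[leLHS]sqrtr1 ler_wsqrtr //.
by rewrite ler1n.
Qed.

Lemma sqr_tau : tau ^+ 2 = Num.sqrt (N%:R).
Proof. by rewrite sqr_sqrtr // sqrtr_ge0. Qed.

Lemma size_gball_le (u : R) (M : nat) : u < M.+1%:R ->
  (size (gball_seq (0%R : R[i]) u) <= (2 * M).+1 ^ 2)%N.
Proof.
move=> hu; have -> : ((2 * M).+1 ^ 2 = size (gbox M))%N.
  by rewrite size_allpairs !size_iota mulnn.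
apply: uniq_leq_size; first exact: uniq_gball.
move=> q; rewrite !mem_filter => /andP[_]; rewrite !mem_gbox cabs0 add0r.
have [u0|u0] := leP 0 u.
  have : (Num.truncn u <= M)%N by rewrite -ltnS truncn_lt_nat.
  by lia.
have -> : Num.truncn u = 0%N by apply/truncn0Pn; rewrite -ltNge; lra.
lia.
Qed.

(** A crude bound suffices. There are finitely many r, each r has a finite list of t, and |r z| <= 2
    / tau <= 2 puts every m in the disc of radius 6 sqrt Q, whatever z and h are. *)
Lemma sup_set_has_ubound : has_ubound (sup_set Q N S ds : set R).
Proof.
pose M := Num.truncn (6 * Num.sqrt (Q%:R : R)).
pose P r := \sum_(t <- ds r) ((2 * M).+1 ^ 2)%:R * (size S)%:R : R.
have P0 r : 0 <= P r by apply: sumr_ge0 => t _; apply: mulr_ge0.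
exists (\sum_(r <- gball_seq (0 : R[i]) tau) P r) => _ [r [z [h [r0 /andP[r1 r2] /andP[z1 z2] _ ->]]]].
apply: (@le_trans _ _ (P r)); last first.
  have rin : r \in gball_seq (0 : R[i]) tau by rewrite mem_gball subr0.
  by rewrite (perm_big _ (perm_to_rem rin)) big_cons lerDl sumr_ge0.
rewrite /inner_sum big_seq /P [leRHS]big_seq; apply: ler_sum => t ht.
have t0 := divsys_neq0 r0 ht.
set B := gball_seq _ _.
apply: (@le_trans _ _ (\sum_(m <- B) (size S)%:R)).
  rewrite big_mkcond /=; apply: ler_sum => m _.
  by case: ifP => // _; apply: A_t_le.
rewrite big_const_seq count_predT iter_addr_0 -[leLHS]mulr_natl ler_wpM2r //.
rewrite ler_nat; apply: size_gball_le.
have hM : 6 * Num.sqrt (Q%:R : R) < M.+1%:R by apply: truncnS_gt.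
apply: le_lt_trans hM.
have q0 : 0 <= Num.sqrt (Q%:R : R) by apply: sqrtr_ge0.
have t1 := gabs_ge1 (R := R) t0; have tau1 := tau_ge1.
have rp : 0 < gabs r by apply: gabs_gt0.
rewrite ler_pdivrMr ?gabs_gt0 // cabsM -/(gabs r).
have rz : gabs r * cabs z <= 2.
  have : gabs r * cabs z <= gabs r * (2 / (gabs r * tau)) by rewrite ler_pM2l.
  have -> : gabs r * (2 / (gabs r * tau)) = 2 / tau.
    by field; rewrite !gt_eqF //; lra.
  move=> h1; apply: (le_trans h1); rewrite ler_pdivrMr; lra.
have rz0 : 0 <= gabs r * cabs z by rewrite mulr_ge0 ?cabs_ge0 // ltW.
nra.
Qed.

Lemma inner_sum_le_sup r (z : R[i]) h : r != (0, 0) -> gabs r <= tau ->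
  (Num.sqrt (N%:R))^-1 <= cabs z <= 2 / (gabs r * tau) -> gcoprime h r ->
  inner_sum Q N S ds r z h <= sup (sup_set Q N S ds).
Proof.
move=> r0 hr hz co; apply: ub_le_sup; first exact: sup_set_has_ubound.
by exists r, z, h; split => //; rewrite gabs_ge1.
Qed.

End BoundedSup.

(** Radial projection onto a disc brings a centre no farther from any point of the disc. It serves
    to move m/(r z) into |y| <= sqrt Q / |t|, the range of centres in [A_t], without losing any
    counted q. *)
Lemma disc_projection (R : realType) (rho : R) (y : R[i]) : 0 <= rho ->
  exists y', cabs y' <= rho /\
    forall w, cabs w <= rho -> cabs (w - y') <= cabs (w - y).
Proof.
move=> rho0; have [h|h] := leP (cabs y) rho; first by exists y.
set Y := cabs y in h; have Y0 : 0 < Y by apply: le_lt_trans h.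
pose lam := rho / Y.
have l1 : lam < 1 by rewrite ltr_pdivrMr // mul1r.
have l0 : 0 <= lam by rewrite divr_ge0 // ltW.
have lamY : lam * Y = rho by rewrite mulfVK ?gt_eqF.
have key (a b c d : R) : c ^+ 2 + d ^+ 2 = Y ^+ 2 -> a ^+ 2 + b ^+ 2 <= rho ^+ 2 ->
    (a - lam * c) ^+ 2 + (b - lam * d) ^+ 2 <= (a - c) ^+ 2 + (b - d) ^+ 2.
  (* Cauchy-Schwarz through Lagrange's identity; the gain in squared distance then factors as (1 -
     lam)(Y^2 + rho Y - 2 (a c + b d)), with both factors nonnegative. *)
  move=> eY hw; have cs : a * c + b * d <= rho * Y.
    apply: le_trans (ler_norm _) _.
    have rY : 0 <= rho * Y by rewrite mulr_ge0 // ltW.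
    rewrite -(@ler_pXn2r _ 2) ?nnegrE // real_normK ?num_real //.
    have : 0 <= (a * d - b * c) ^+ 2 by apply: sqr_ge0.
    have : (a ^+ 2 + b ^+ 2) * (c ^+ 2 + d ^+ 2) <= rho ^+ 2 * Y ^+ 2.
      by rewrite eY ler_wpM2r // sqr_ge0.
    lra.
  rewrite -subr_ge0.
  have -> : (a - c) ^+ 2 + (b - d) ^+ 2 - ((a - lam * c) ^+ 2 + (b - lam * d) ^+ 2) =
     (1 - lam) * ((c ^+ 2 + d ^+ 2) + lam * (c ^+ 2 + d ^+ 2) - 2 * (a * c + b * d)).
    ring.
  rewrite eY mulr_ge0 ?subr_ge0 ?(ltW l1) // expr2 mulrA lamY.
  have : rho * Y <= Y * Y by rewrite ler_wpM2r // ltW.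
  lra.
exists ((lam%:C)%C * y); split; first by rewrite cabsM cabs_real // lamY.
move=> w hw; rewrite -(@ler_pXn2r _ 2) ?nnegrE ?cabs_ge0 //.
have := key (complex.Re w) (complex.Im w) (complex.Re y) (complex.Im y).
rewrite -!sqr_cabs => /(_ erefl); rewrite [_ <= rho ^+ 2]ler_pXn2r ?nnegrE ?cabs_ge0 // => /(_ hw).
by rewrite !sqr_cabs; case: (w) (y) => [a b] [c d] /=; rewrite !mul0r subr0 addr0.
Qed.

(** * Fractions in a disc encoded as triples (t, m, q) *)

Section Counting.
Context {R : realType} (Q N : nat) (S : seq gi) (ds : gi -> seq gi).
Local Notation gtoC := (@gtoC R).
Local Notation gabs := (@gabs R).
Hypothesis N_gt0 : (0 < N)%N.
Hypothesis uniqS : uniq S.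
Hypothesis hS : forall q, q \in S -> q != (0, 0) /\ gabs q <= Num.sqrt (Q%:R).
Hypothesis dsP : forall r, r != (0, 0) -> is_divsys r (ds r).

Let tau : R := Num.sqrt (Num.sqrt (N%:R)).
Let rho : R := (Num.sqrt (N%:R))^-1.
Let sQ : R := Num.sqrt (Q%:R).
Let Ssup : R := sup (sup_set Q N S ds).

(* The pair [(q, a)] encodes the fraction [a / q]. *)
Definition fraction_near (c : R[i]) (d : R) (p : gi * gi) : Prop :=
  [/\ p.1 \in S, gcoprime p.2 p.1 & cabs (gtoC p.2 / gtoC p.1 - c) <= d].

Let sN_gt0 : 0 < Num.sqrt (N%:R) :> R.
Proof. by rewrite sqrtr_gt0 ltr0n. Qed.

Let rho_gt0 : 0 < rho. Proof. by rewrite invr_gt0. Qed.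

Definition cross (r b : gi) (p : gi * gi) := gsub (gmul p.2 r) (gmul b p.1).

Lemma cross0_count (r b : gi) (c : R[i]) d (L : seq (gi * gi)) :
  r != (0, 0) -> gcoprime b r -> uniq L ->
  {in L, forall p, fraction_near c d p} ->
  (size [seq p <- L | cross r b p == (0%R, 0%R)] <= 4)%N.
Proof.
move=> r0 co uL hL.
pose us : seq gi := [:: (1, 0); (-1, 0); (0, 1); (0, -1)].
pose B := [seq (gmul u r, gmul u b) | u <- us].
have -> : 4%N = size B by [].
apply: uniq_leq_size; first by rewrite filter_uniq.
move=> [q a]; rewrite mem_filter => /andP[/eqP + /hL [/= qS coa _]].
move=> /gsub_eq0 /= e; have [q0 _] := hS qS.
have [k ek] : gdvd q r by apply: (gdvd_gauss coa); exists b; rewrite e gmulC.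
have [l el] : gdvd r q.
  by apply: (gdvd_gauss co); exists a; rewrite -e gmulC.
have ul : gunit l.
  exists k; apply: (gmulI r0); rewrite gmulA -el -ek gmul1 //.
have -> : (q, a) = (gmul l r, gmul l b).
  congr pair; first by rewrite gmulC.
  by apply: (gmulI r0); rewrite gmulC e el; gring.
exact: (map_f (fun u => (gmul u r, gmul u b)) (gunit_mem ul)).
Qed.

Lemma cross_data (r b x y : gi) (z : R[i]) (p : gi * gi) :
  r != (0, 0) -> gadd (gmul b x) (gmul r y) = (1, 0) ->
  rho <= cabs z -> fraction_near (gtoC b / gtoC r + z) rho p ->
  cross r b p != (0, 0) ->
  exists t m k q, [/\ t \in ds r, t != (0, 0), r = gmul t k, p.1 = gmul t q &
    [/\ cross r b p = gmul t m, m != (0, 0), gcoprime m k,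
     gcong q (gmul (gmul (-1, 0) x) m) k &
     gabs m <= 3 * cabs (gtoC r * z) * sQ / gabs t /\
     cabs (gtoC q - gtoC m / (gtoC r * z)) <=
       sQ / (Num.sqrt (N%:R) * cabs (z * gtoC t))]].
Proof.
case: p => q0 a r0 bez hz [/= qS coa hnear] D0.
have [q0n0 hq0] := hS qS.
have [t [m [k [tds t0 em ek co]]]] := divsys_gcd (cross r b (q0, a)) r0 (dsP r0).
have m0 : m != (0, 0) by apply: contra_neq D0 => m0; rewrite em m0 gmul0.
(* Multiply q0 by b x + r y = 1 and replace b q0 by a r - t m: then q0 = - x t m + r (x a + y q0),
   which shows both that t divides q0 and the residue of the quotient modulo k. *)
have eq0 : q0 = gmul t (gadd (gmul (gmul (-1, 0) x) m)
     (gmul k (gadd (gmul x a) (gmul y q0)))).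
  have -> : gmul t (gadd (gmul (gmul (-1, 0) x) m)
     (gmul k (gadd (gmul x a) (gmul y q0)))) =
     gadd (gmul (gmul (-1, 0) x) (gmul t m))
       (gmul (gmul t k) (gadd (gmul x a) (gmul y q0))) by gring.
  rewrite -em -ek -[LHS]g1mul -bez /cross; gring.
set q := gadd _ _ in eq0; exists t, m, k, q; split => //; split => //.
  by exists (gadd (gmul x a) (gmul y q0)); rewrite /q; gring.
have [tp rp] := (gabs_gt0 (R := R) t0, gabs_gt0 (R := R) r0).
have z0 : 0 < cabs z by apply: lt_le_trans hz.
have zn0 : z != 0 by rewrite -cabs_eq0 gt_eqF.
have [tn0 rn0 qn0] : [/\ gtoC t != 0, gtoC r != 0 & gtoC q0 != 0] by rewrite !gtoC_eq0.
set w := gtoC q - gtoC m / (gtoC r * z).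
(* Dividing t m = a r - b q0 by r z gives (a/q0 - b/r) q0/z; splitting off z from the bracket leaves
   q0 plus the small error displayed here. *)
have ew : gtoC t * w = - ((gtoC a / gtoC q0 - (gtoC b / gtoC r + z)) * gtoC q0 / z).
  have eT : gtoC t * gtoC m = gtoC a * gtoC r - gtoC b * gtoC q0.
    by rewrite -gtoCM -em /cross gtoCB !gtoCM.
  rewrite /w mulrBr -gtoCM -eq0 mulrA eT; field.
  by rewrite zn0 rn0 qn0.
have sQ0 : 0 <= sQ by apply: sqrtr_ge0.
have hw : gabs t * cabs w <= rho * sQ / cabs z.
  rewrite -cabsM ew cabsN !cabsM cabsV ler_wpM2r ?invr_ge0 ?cabs_ge0 //.
  by rewrite ler_pM ?cabs_ge0.
have hq : gabs t * gabs q <= sQ by rewrite -gabsM -eq0.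
split; last first.
  rewrite cabsM -/(gabs t) -(ler_pM2l tp); apply: (le_trans hw).
  rewrite le_eqVlt; apply/orP; left; apply/eqP; rewrite /rho; field.
  by rewrite !gt_eqF.
have hw2 : gabs t * cabs w <= sQ.
  apply: (le_trans hw); rewrite ler_pdivrMr // mulrC ler_wpM2l //.
have -> : gabs m = gabs r * cabs z * cabs (gtoC q - w).
  by rewrite -!cabsM; congr cabs; rewrite /w; field; rewrite zn0 rn0.
have : cabs (gtoC q - w) <= gabs q + cabs w by rewrite -(cabsN w) cabsD.
(* Both |t q| and |t w| are at most sqrt Q, the latter because rho <= |z|; their sum lies within the
   3 sqrt Q of the range of m. *)
rewrite -(ler_pM2l tp) => hX; have {hX} : gabs t * cabs (gtoC q - w) <= 3 * sQ by lra.
have P0 : 0 <= gabs r * cabs z by rewrite mulr_ge0 ?cabs_ge0.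
move=> /(ler_wpM2l P0); rewrite cabsM -/(gabs r) ler_pdivlMr //; lra.
Qed.

Lemma size_triples (r : gi) (z : R[i]) h (c : gi -> gi -> R[i]) : r != (0, 0) ->
  (forall t m, t \in ds r -> cabs (c t m) <= sQ / gabs t) ->
  (size [seq (t, x) | t <- ds r, x <-
     [seq (m, q) | m <- [seq m <- gball_seq (0%R : R[i]) (3 * cabs (gtoC r * z) * sQ / gabs t) |
         (m != (0%R, 0%R)) && `[< gcoprime m (gquo r t) >]],
       q <- [seq q <- gball_seq (c t m) (sQ / (Num.sqrt (N%:R) * cabs (z * gtoC t))) |
         (gmul t q \in S) && `[< gcong q (gmul h m) (gquo r t) >]]]])%:R
    <= inner_sum Q N S ds r z h.
Proof.
move=> r0 hc; rewrite size_allpairs_dep sumnE big_map natr_sum /inner_sum.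
rewrite big_seq [leRHS]big_seq; apply: ler_sum => t ht.
rewrite size_allpairs_dep sumnE big_map big_filter natr_sum.
apply: ler_sum => m _; rewrite size_filter.
by apply: Acount_le_A_t (hc t m ht) => //; apply: (divsys_neq0 dsP r0 ht).
Qed.

Lemma count_near_rational (r b : gi) (z : R[i]) (L : seq (gi * gi)) :
  r != (0, 0) -> gcoprime b r -> gabs r <= tau ->
  rho <= cabs z <= 2 / (gabs r * tau) -> uniq L ->
  {in L, forall p, fraction_near (gtoC b / gtoC r + z) rho p} ->
  0 <= Ssup /\ (size L)%:R <= 4 + Ssup.
Proof.
move=> r0 co hr hz uL hL; have [x [y bez]] := gcoprime_bezout co.
(* This is - x with b x = 1 modulo r; it depends only on b and r, so one h serves every fraction in
   the disc. *)
set h := gmul (-1, 0) x.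
have coh : gcoprime h r.
  by apply: (@bezout_gcoprime _ _ (gmul (-1, 0) b) y); rewrite -bez /h; gring.
have hsup : inner_sum Q N S ds r z h <= Ssup by apply: inner_sum_le_sup.
split; first by apply: le_trans hsup; apply: inner_sum_ge0.
have /andP[hz1 _] := hz.
have proj t m : exists y' : R[i], cabs y' <= sQ / gabs t /\
    forall w, cabs w <= sQ / gabs t ->
      cabs (w - y') <= cabs (w - gtoC m / (gtoC r * z)).
  by apply: disc_projection; rewrite divr_ge0 ?sqrtr_ge0 ?cabs_ge0.
pose c t m : R[i] := sval (cid (proj t m)).
have cP1 t m : cabs (c t m) <= sQ / gabs t by rewrite /c; case: cid => ? [].
have cP2 t m w : cabs w <= sQ / gabs t ->
    cabs (w - c t m) <= cabs (w - gtoC m / (gtoC r * z)).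
  by rewrite /c; case: cid => ? [_] /= H; apply: H.
rewrite -(count_predC (fun p => cross r b p == (0, 0)) L) natrD lerD //.
  by rewrite -size_filter ler_nat (cross0_count r0 co uL hL).
apply: le_trans hsup; apply: (le_trans _ (@size_triples r z h c r0 (fun t m _ => cP1 t m))).
set B := flatten _.
(* Decoding map: the denominator is t q, and the numerator is recovered from a r = t m + b (t q).
   The fractions lie in the image of the triples, so counting triples suffices. *)
pose g (x : gi * (gi * gi)) : gi * gi :=
  (gmul x.1 x.2.2, gquo (gadd (gmul x.1 x.2.1) (gmul b (gmul x.1 x.2.2))) r).
rewrite -size_filter ler_nat -(size_map g B).
apply: uniq_leq_size; first by rewrite filter_uniq.
move=> p; rewrite mem_filter => /andP[/= pD pL].
have [t [m [k [q [tds t0 ek ep [em m0 com cong [hm hq]]]]]]] :=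
  cross_data r0 bez hz1 (hL p pL) pD.
have -> : p = g (t, (m, q)).
  rewrite /g /= -em -ep /cross; case: (p) => q1 a1 /=; congr pair.
  have -> : gadd (gsub (gmul a1 r) (gmul b q1)) (gmul b q1) = gmul r a1 by gring.
  by rewrite gquo_mul.
have [pS _ _] := hL p pL; have [_ hpQ] := hS pS.
have gk : gquo r t = k by rewrite ek gquo_mul.
have hqt : gabs q <= sQ / gabs t.
  by rewrite ler_pdivlMr ?gabs_gt0 // mulrC -gabsM -ep.
apply: map_f; apply: allpairs_f_dep => //; apply: allpairs_f_dep.
  rewrite mem_filter mem_gball subr0 m0 gk /= hm andbT; exact/asboolP.
rewrite mem_filter mem_gball -ep pS gk /=; apply/andP; split; first exact/asboolP.
exact: le_trans (cP2 _ _ _ hqt) hq.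
Qed.

Definition axis_points : seq R[i] :=
  [:: (rho%:C)%C; ((- rho)%:C)%C; (0 +i* rho)%C; (0 +i* (- rho))%C].

Lemma cabs_axis_point w : w \in axis_points -> cabs w = rho.
Proof.
have rr : Num.sqrt (rho ^+ 2) = rho by rewrite sqrtr_sqr ger0_norm // ltW.
rewrite !inE => /or4P[] /eqP ->;
  by rewrite /cabs /= ?sqrrN ?[0 ^+ 2]expr0n ?addr0 ?add0r.
Qed.

(** By symmetry let u >= |w|. Then T = u^2 + w^2 satisfies T <= 2 u^2 and T <= 2 rho^2, hence T <= 2
    u rho, which is membership in the disc about rho. The radius sqrt 2 rho is sharp: neighbouring
    circles cross at rho (1 + i) and its rotations. *)
Lemma axis_points_cover (v : R[i]) : cabs v ^+ 2 <= 2 * rho ^+ 2 ->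
  exists2 w, w \in axis_points & cabs (v - w) <= rho.
Proof.
have key (u w : R) : u ^+ 2 + w ^+ 2 <= 2 * rho ^+ 2 -> `|w| <= u ->
    (u - rho) ^+ 2 + w ^+ 2 <= rho ^+ 2.
  move=> h1 h2; have u0 : 0 <= u by apply: le_trans h2.
  have w2 : w ^+ 2 <= u ^+ 2.
    by rewrite -[w ^+ 2]real_normK ?num_real // ler_pXn2r ?nnegrE.
  have T0 : 0 <= u ^+ 2 + w ^+ 2 by rewrite addr_ge0 ?sqr_ge0.
  have : (u ^+ 2 + w ^+ 2) ^+ 2 <= (2 * u * rho) ^+ 2.
    have -> : (2 * u * rho) ^+ 2 = (2 * u ^+ 2) * (2 * rho ^+ 2) by ring.
    rewrite expr2 ler_pM //; lra.
  rewrite ler_pXn2r ?nnegrE ?mulr_ge0 ?(ltW rho_gt0) // => h; lra.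
have fin (a b c d : R) : (a - c) ^+ 2 + (b - d) ^+ 2 <= rho ^+ 2 ->
    cabs ((a +i* b)%C - (c +i* d)%C) <= rho.
  have -> : (a - c) ^+ 2 + (b - d) ^+ 2 = cabs ((a +i* b)%C - (c +i* d)%C) ^+ 2.
    by rewrite sqr_cabs.
  by rewrite ler_pXn2r ?nnegrE ?cabs_ge0 // ltW.
rewrite sqr_cabs; case: v => x y /= hv.
have [xy|yx] := leP `|y| `|x|.
  have [x0|x0] := leP 0 x.
    rewrite (ger0_norm x0) in xy; exists (rho%:C)%C; first by rewrite !inE eqxx.
    by apply: fin; rewrite subr0; apply: key.
  rewrite (ltr0_norm x0) in xy; exists ((- rho)%:C)%C; first by rewrite !inE eqxx !orbT.
  apply: fin; rewrite subr0; have := key (- x) y; rewrite sqrrN => /(_ hv xy); lra.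
have [y0|y0] := leP 0 y.
  rewrite (ger0_norm y0) in yx; exists (0 +i* rho)%C; first by rewrite !inE eqxx !orbT.
  apply: fin; rewrite subr0 addrC; apply: key; last exact: ltW.
  by rewrite addrC.
rewrite (ltr0_norm y0) in yx; exists (0 +i* (- rho))%C; first by rewrite !inE eqxx !orbT.
apply: fin; rewrite subr0; have := key (- y) x; rewrite sqrrN addrC.
by move=> /(_ hv (ltW yx)); lra.
Qed.

Lemma count_near (al : R[i]) (L : seq (gi * gi)) (d : R) :
  0 <= d -> d ^+ 2 <= rho ^+ 2 / 8 -> uniq L ->
  {in L, forall p, fraction_near al d p} ->
  0 <= Ssup /\ (size L)%:R <= 16 * (1 + Ssup).
Proof.
move=> d0 hd uL hL; have [r [b [r0 co hr hb]]] := dirichlet_gi al (tau_ge1 N_gt0).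
have rp := gabs_gt0 (R := R) r0.
have tau0 : 0 < tau by apply: lt_le_trans (tau_ge1 N_gt0).
have rn0 : gtoC r != 0 by rewrite gtoC_eq0.
pose z := al - gtoC b / gtoC r.
have ez : gabs r * cabs z <= 2 / tau.
  rewrite -cabsM; have -> : gtoC r * z = gtoC r * al - gtoC b; last by [].
  by rewrite /z; field.
have ez2 : cabs z <= 2 / (gabs r * tau).
  by rewrite invfM mulrCA -ler_pdivlMl // mulrC // in ez *; rewrite mulrC.
have rho_d : d <= rho.
  rewrite -(@ler_pXn2r _ 2) ?nnegrE ?(ltW rho_gt0) //.
  have : 0 <= rho ^+ 2 by apply: sqr_ge0.
  lra.
(* Since |r| tau <= tau^2 = sqrt N, the modulus rho of the four substitute offsets also obeys the
   upper limit imposed on |z|. *)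
have rt : rho <= 2 / (gabs r * tau).
  have h1 : gabs r * tau <= Num.sqrt (N%:R).
    by rewrite -(sqr_tau (R := R) N) expr2 ler_pM2r.
  have h2 : 0 < gabs r * tau by apply: mulr_gt0.
  rewrite ler_pdivlMr // /rho mulrC ler_pdivrMr //; lra.
have [hz|hz] := leP rho (cabs z).
  have hz' : rho <= cabs z <= 2 / (gabs r * tau) by rewrite hz.
  have nz : {in L, forall p, fraction_near (gtoC b / gtoC r + z) rho p}.
    move=> p /hL [pS cop hp]; split => //.
    have -> : gtoC b / gtoC r + z = al by rewrite /z; ring.
    exact: le_trans hp rho_d.
  have [S0 h] := count_near_rational r0 co hr hz' uL nz.
  by split => //; lra.
pose P w p := `[< fraction_near (gtoC b / gtoC r + w) rho p >].
have hw w : w \in axis_points ->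
    0 <= Ssup /\ (size [seq p <- L | P w p])%:R <= 4 + Ssup.
  move=> hw; apply: (count_near_rational (z := w) r0 co hr).
  - by rewrite (cabs_axis_point hw) lexx rt.
  - by rewrite filter_uniq.
  - by move=> p; rewrite mem_filter => /andP[/asboolP].
have S0 : 0 <= Ssup by have [] := hw _ (mem_head _ _).
split => //.
have /size_le_cover : {in L, forall p, exists2 w, w \in axis_points & P w p}.
  move=> p /hL [pS cop hp].
  have [|w hw1 hw2] := @axis_points_cover (gtoC p.2 / gtoC p.1 - gtoC b / gtoC r).
    set v := _ - _; have hv : cabs v <= d + rho.
      have -> : v = (gtoC p.2 / gtoC p.1 - al) + z by rewrite /v /z; ring.
      by apply: (le_trans (cabsD _ _)); rewrite lerD // ltW.
    have h3 : cabs v ^+ 2 <= (d + rho) ^+ 2.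
      by rewrite ler_pXn2r ?nnegrE ?cabs_ge0 // addr_ge0 // ltW.
    apply: (le_trans h3).
    (* This gives 2 d rho <= rho^2/4 + 4 d^2; with 8 d^2 <= rho^2 it yields (d + rho)^2 <= (15/8)
       rho^2, inside the covered radius. *)
    have : 0 <= (rho - 4 * d) ^+ 2 by apply: sqr_ge0.
    have : 0 <= (3 * d - rho) ^+ 2 by apply: sqr_ge0.
    nra.
  exists w => //; apply/asboolP; split => //.
  by rewrite opprD addrA.
move=> hsz; apply: (@le_trans _ _ (\sum_(w <- axis_points) size [seq p <- L | P w p])%:R).
  by rewrite ler_nat.
rewrite natr_sum big_seq; apply: (@le_trans _ _ (\sum_(w <- axis_points | w \in axis_points) (4 + Ssup))).
  by apply: ler_sum => w /hw [].
rewrite -big_seq !big_cons big_nil; lra.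
Qed.

End Counting.

(** * From the torus to discs in the plane, and the final constant *)

Lemma ReM_gtoC (R : realType) (n : gi) (w : R[i]) :
  complex.Re (gtoC R n * w) = n.1%:~R * complex.Re w + n.2%:~R * (- complex.Im w).
Proof. by case: w => a b /=; rewrite mulrN. Qed.

(** The radius is half the diagonal of a square of side 1/H. The second torus coordinate is - Im, as
    in Re(n w), hence the sign in the imaginary part of the integer shift. *)
Lemma near1_pair (R : realType) (H : nat) (w al : R[i]) :
  near1 H (complex.Re w) (complex.Re al) ->
  near1 H (- complex.Im w) (- complex.Im al) ->
  exists k : gi, cabs (w - gtoC R k - al) <= Num.sqrt (2 * (2 * H%:R) ^- 2).
Proof.
move=> /asboolP[k hk] /asboolP[l hl]; exists (k, - l).
rewrite -(@ler_pXn2r _ 2) ?nnegrE ?cabs_ge0 ?sqrtr_ge0 //.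
rewrite sqr_sqrtr; last by rewrite mulr_ge0 // invr_ge0 sqr_ge0.
have sq (u v : R) : `|u| <= v -> u ^+ 2 <= v ^+ 2.
  move=> h; rewrite -[u ^+ 2]real_normK ?num_real // ler_pXn2r ?nnegrE //.
  exact: le_trans h.
have := sq _ _ hk; have := sq _ _ hl; rewrite exprVn sqr_cabs.
case: w al {hk hl} => [a b] [c d] /=; rewrite mulrNz; lra.
Qed.

Lemma frac_pairs_uniq (S : seq gi) (crs : gi -> seq gi) : uniq S ->
  (forall q, q \in S -> is_crs q (crs q)) ->
  uniq [seq (q, b) | q <- S, b <- [seq b <- crs q | `[< gcoprime b q >]]].
Proof.
move=> uS hcrs; apply: allpairs_uniq_dep => //.
  by move=> q /hcrs [u _]; rewrite filter_uniq.
by move=> [q b] [q' b'] _ _ /= [-> ->].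
Qed.

(** The shift varies with the fraction, so injectivity rests on the residue system: equal shifted
    numerators over the same q are congruent modulo q, hence have the same representative. *)
Lemma shift_injective (S : seq gi) (crs : gi -> seq gi) (w : gi * gi -> gi) :
  (forall q, q \in S -> is_crs q (crs q)) ->
  {in [seq (q, b) | q <- S, b <- [seq b <- crs q | `[< gcoprime b q >]]] &,
    injective (fun p => (p.1, gsub p.2 (gmul (w p) p.1)))}.
Proof.
move=> hcrs _ _ /allpairsPdep[q [b [qS + ->]]] /allpairsPdep[q' [b' [qS' + ->]]] /=.
rewrite !mem_filter => /andP[_ hb] /andP[_ hb'] e.
have /= e1 := congr1 fst e; have /= e2 := congr1 snd e.
subst q'; have [_ /(_ b) [c [_ hc]]] := hcrs q qS.
suff -> : b = b' by [].
rewrite -(hc b) ?(hc b') //; split => //; last first.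
  by exists (0, 0); rewrite gmul0; gring.
exists (gsub (w (q, b)) (w (q, b'))).
have eb : b = gadd (gsub b (gmul (w (q, b)) q)) (gmul (w (q, b)) q).
  by case: (b) => ? ?; gring.
by rewrite {1}eb e2; gring.
Qed.

Lemma gcoprime_shift (b q k : gi) : gcoprime b q -> gcoprime (gsub b (gmul k q)) q.
Proof.
move=> /gcoprime_bezout [x [y e]].
by apply: (@bezout_gcoprime _ _ x (gadd y (gmul k x))); rewrite -e; gring.
Qed.

Theorem theorem1 (R : realType) :
  exists c1 : R, 0 < c1 /\
  forall (Q N : nat) (a : gi -> R[i]) (S : seq gi)
         (crs ds : gi -> seq gi),
    (0 < N)%N ->
    uniq S ->
    (forall q, q \in S -> q != (0, 0) /\ @gabs R q <= Num.sqrt (Q%:R)) ->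
    (forall q, q != (0, 0) -> is_crs q (crs q)) ->
    (forall r, r != (0, 0) -> is_divsys r (ds r)) ->
    lhs N a S crs <=
      c1 * N%:R * Zsum N a * (1 + sup (@sup_set R Q N S ds)).
Proof.
(* 256 comes from the large sieve, one 16 from H^2 <= 16 N, the other from the disc count 16 (1 +
   sup). *)
exists (256 * 16 * 16); split; first by rewrite !mulr_gt0.
move=> Q N a S crs ds N0 uS hS hcrs0 hds.
have hcrs q : q \in S -> is_crs q (crs q) by move=> /hS [/hcrs0].
pose sN : R := Num.sqrt N%:R.
have sN1 : 1 <= sN by rewrite -sqrtr1 ler_wsqrtr // ler1n.
have sN2 : sN ^+ 2 = N%:R by rewrite sqr_sqrtr.
have /andP[ht1 ht2] := truncn_itv (le_trans ler01 sN1).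
set T := Num.truncn sN in ht1 ht2.
(* The lower bound 2 sqrt N <= H makes d^2 = 1/(2 H^2) at most 1/(8 N) and puts all frequencies in
   the box; H <= 4 sqrt N uses N >= 1. *)
pose H := (2 * T.+1)%N.
have H0 : (0 < H)%N by [].
have eH : H%:R = 2 * T.+1%:R :> R by rewrite natrM.
have hH1 : 2 * sN <= H%:R by rewrite eH; lra.
have hH2 : H%:R <= 4 * sN by rewrite eH -natr1; lra.
pose d : R := Num.sqrt (2 * (2 * H%:R) ^- 2).
have d2 : d ^+ 2 <= (Num.sqrt N%:R)^-1 ^+ 2 / 8.
  rewrite sqr_sqrtr ?mulr_ge0 ?invr_ge0 ?sqr_ge0 // -/sN.
  have X0 : 4 * sN <= 2 * H%:R by lra.
  set X := 2 * H%:R in X0 *; have sN0 : 0 < sN by lra.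
  have -> : sN^-1 ^+ 2 / 8 = 2 * ((4 * sN) ^+ 2)^-1 by field; apply: lt0r_neq0.
  rewrite ler_pM2l // lef_pV2 ?posrE ?exprn_gt0 ?ler_pXn2r ?nnegrE //; lra.
pose L := [seq (q, b) | q <- S, b <- [seq b <- crs q | `[< gcoprime b q >]]].
pose pt (p : gi * gi) : R[i] := gtoC R p.2 / gtoC R p.1.
pose K : R := 16 * (1 + sup (@sup_set R Q N S ds)).
have uL : uniq L by apply: frac_pairs_uniq.
have LP p : p \in L -> p.1 \in S /\ gcoprime p.2 p.1.
  move=> /allpairsPdep[q [b [qS + ->]]]; rewrite mem_filter => /andP[/asboolP ? _].
  by [].
have hcount (al be : R) : 0 <= sup (@sup_set R Q N S ds) /\
    (count (fun p => near1 H (complex.Re (pt p)) al && near1 H (- complex.Im (pt p)) be) L)%:R <= K.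
  pose alp : R[i] := (al +i* (- be))%C.
  have hk p : exists k : gi, near1 H (complex.Re (pt p)) al &&
     near1 H (- complex.Im (pt p)) be -> cabs (pt p - gtoC R k - alp) <= d.
    have [/andP[h1 h2]|h] := boolP (near1 H (complex.Re (pt p)) al &&
       near1 H (- complex.Im (pt p)) be); last by exists (0, 0).
    have [|k hk] := @near1_pair R H (pt p) alp h1; first by rewrite /= opprK.
    by exists k.
  pose w p := sval (cid (hk p)).
  have wP p : near1 H (complex.Re (pt p)) al && near1 H (- complex.Im (pt p)) be ->
      cabs (pt p - gtoC R (w p) - alp) <= d by rewrite /w; case: cid.
  rewrite -size_filter; set L' := filter _ L.
  pose sh p := (p.1, gsub p.2 (gmul (w p) p.1)).
  rewrite -(size_map sh).
  apply: (count_near N0 uS hS hds _ d2).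
  - exact: sqrtr_ge0.
  - rewrite map_inj_in_uniq ?filter_uniq // => p p'.
    rewrite !mem_filter => /andP[_ pL] /andP[_ p'L].
    exact: (shift_injective (w := w) hcrs pL p'L).
  - move=> _ /mapP[p + ->]; rewrite mem_filter => /andP[/wP hp /LP [pS cop]].
    split => //=; first exact: gcoprime_shift.
    have [q0 _] := hS _ pS; have qn0 : gtoC R p.1 != 0 by rewrite gtoC_eq0.
    have -> : gtoC R (gsub p.2 (gmul (w p) p.1)) / gtoC R p.1 = pt p - gtoC R (w p).
      by rewrite gtoCB gtoCM /pt mulrBl mulfK.
    exact: hp.
(* Any point of the torus will do: Dirichlet's theorem there yields a member of the set, hence a
   nonnegative supremum, even when [L] is empty. *)
have [S0 _] := hcount 0 0.
have K0 : 0 < K by rewrite /K mulr_gt0 // ltr_pwDl.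
have hK al be := (hcount al be).2.
pose ns := [seq n <- gbox N | gnorm n <= N%:Z].
have uns : uniq ns by rewrite filter_uniq // uniq_gbox.
have hns : {in ns, forall n, (`|n.1| <= H%:Z) && (`|n.2| <= H%:Z)}.
  move=> n; rewrite mem_filter => /andP[hn _].
  have s1 := sqr_ge0 n.1; have s2 := sqr_ge0 n.2.
  have small (c : int) : c ^+ 2 <= gnorm n -> `|c| <= H%:Z.
    move=> hc; rewrite -(ler_int R); apply: (@le_trans _ _ sN); last first.
      by rewrite -pmulrn; lra.
    rewrite -(@ler_pXn2r _ 2) ?nnegrE ?ler0z //; last by lra.
    rewrite sN2 -rmorphXn real_normK ?num_real // pmulrn ler_int.
    exact: le_trans hn.
  by rewrite !small // /gnorm ?lerDl ?lerDr.
have := large_sieve H0 K0 hK a uns hns.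
have -> : \sum_(s <- L) cabs (\sum_(n <- ns) a n * ee (n.1%:~R * complex.Re (pt s) +
    n.2%:~R * - complex.Im (pt s))) ^+ 2 = lhs N a S crs.
  rewrite /L big_allpairs_dep /lhs; apply: eq_bigr => q _.
  rewrite big_filter; apply: eq_bigr => b _.
  rewrite big_filter; congr (cabs _ ^+ 2); apply: eq_bigr => n _.
  by rewrite -mulrA ReM_gtoC.
move=> h; apply: (le_trans h).
have -> : \sum_(n <- ns) cabs (a n) ^+ 2 = Zsum N a by rewrite big_filter.
have Z0 : 0 <= Zsum N a by apply: sumr_ge0 => n _; apply: sqr_ge0.
have H2 : H%:R ^+ 2 <= 16 * N%:R :> R.
  have : H%:R ^+ 2 <= (4 * sN) ^+ 2 by rewrite ler_pXn2r ?nnegrE //; lra.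
  by rewrite exprMn sN2; lra.
have -> : 256 * 16 * 16 * N%:R * Zsum N a * (1 + sup (@sup_set R Q N S ds)) =
   (16 * N%:R) * (256 * K * Zsum N a) by rewrite /K; ring.
have -> : 256 * H%:R ^+ 2 * K * Zsum N a = H%:R ^+ 2 * (256 * K * Zsum N a) by ring.
by rewrite ler_wpM2r // mulr_ge0 // mulr_ge0 // ltW.
Qed.
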